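(* Let $n$ be a positive integer and $X,Y>0$. Then \[ \#\{f\in\Sigma_n: |\Delta(f)|<X,\ h(f)<Y\}\ll \nu(\Sigma_n)\bigl(Y^2+n\bigr)\min\{Y^3,X^{1/2}\}+nY^2 . \]
   Context: For a ring $R$, $V(R)$ is the set of monic cubic polynomials $x^3+tx^2+Ax+B$ with $t\in\{-1,0,1\}$ and $A,B\in R$; $\Delta(f)$ is the discriminant and $h(f)$ is the maximum absolute value of the complex roots of $f$. For $f\in V(\mathbb{Z})$ with $\Delta(f)\ne0$, $\mathrm{ind}(f)$ is the index of $\mathbb{Z}[x]/(f)$ in the ring of integral elements of $\mathbb{Q}[x]/(f)$. $\Sigma_n$ is the set of $f\in V(\mathbb{Z})$ with $\Delta(f)\neq0$ and $n\mid\mathrm{ind}(f)$. $\nu(\Sigma_n)$ is the measure of the closure of $\Sigma_n$ in $V(\hat{\mathbb{Z}})=\{-1,0,1\}\times\hat{\mathbb{Z}}^2$ with respect to the probability measure (uniform in $t$, normalized Haar in $(A,B)$). *)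

(* Defs.v *)
From HB Require Import structures.
From mathcomp Require Import all_boot all_order all_algebra.
From mathcomp Require Import boolp classical_sets reals.
From mathcomp Require Import complex.
Set Implicit Arguments. Unset Strict Implicit. Unset Printing Implicit Defensive.
Import Order.TTheory GRing.Theory Num.Theory.
Local Open Scope ring_scope.

(* An element of V(Z): a triple (t, A, B) of integers standing for
   x^3 + t x^2 + A x + B, with the constraint t \in {-1,0,1}. *)
Definition cub := (int * int * int)%type.
Definition cub_t (f : cub) : int := f.1.1.
Definition cub_A (f : cub) : int := f.1.2.
Definition cub_B (f : cub) : int := f.2.
Definition inV (f : cub) : bool := cub_t f \in [:: (-1)%R; 0%R; 1%R].

Definition cubpoly (F : nzRingType) (f : cub) : {poly F} :=
  'X^3 + (cub_t f)%:~R *: 'X^2 + (cub_A f)%:~R *: 'X + ((cub_B f)%:~R)%:P.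

Definition disc (f : cub) : int :=
  let a := cub_t f in let b := cub_A f in let c := cub_B f in
  a ^+ 2 * b ^+ 2 - 4 * b ^+ 3 - 4 * a ^+ 3 * c - 27 * c ^+ 2 + 18 * a * b * c.

Definition h_lt (R : realType) (f : cub) (Y : R) : Prop :=
  forall z : R[i], root (cubpoly R[i] f) z -> Num.sqrt (complex.Re z ^+ 2 + complex.Im z ^+ 2) < Y.

(* The element c0 + c1 x + c2 x^2 of Q[x]/(f), represented by a polynomial. *)
Definition elt (c : rat * rat * rat) : {poly rat} :=
  (c.1.1)%:P + c.1.2 *: 'X + c.2 *: 'X^2.

Definition integral_elt (f : cub) (c : rat * rat * rat) : Prop :=
  exists g : {poly int}, g \is monic /\
    cubpoly rat f %| (map_poly (fun z : int => z%:~R) g \Po elt c).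

Definition in_unit_cube (c : rat * rat * rat) : bool :=
  [&& 0 <= c.1.1 < 1, 0 <= c.1.2 < 1 & 0 <= c.2 < 1].

(* ind f = k : the index [O : Z[x]/(f)] is k, where O is the ring of
   integral elements of Q[x]/(f).  Z[x]/(f) is the lattice of classes with
   integer coordinates in the basis 1, x, x^2, so O / Z[x]/(f) is in bijection
   with the integral elements whose coordinates lie in [0,1); k is their number. *)
Definition ind_is (f : cub) (k : nat) : Prop :=
  exists s : seq (rat * rat * rat), [/\ uniq s, size s = k &
    forall c, c \in s <-> (in_unit_cube c /\ integral_elt f c)].

Definition Sigma (n : nat) (f : cub) : Prop :=
  [/\ inV f, disc f != 0 & exists k, ind_is f k /\ (n %| k)%N].

Definition nres (S : cub -> Prop) (t : int) (m : nat) : nat :=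
  #|[set p : 'I_m * 'I_m | `[< exists A B : int,
       S (t, A, B) /\ (A == (p.1 : nat)%:Z %[mod m%:Z])%Z
                   /\ (B == (p.2 : nat)%:Z %[mod m%:Z])%Z >] ]|.

(* Measure of the closure of S in V(Zhat) = {-1,0,1} x Zhat^2 (uniform in t,
   normalised Haar in (A,B)): the closure is the decreasing intersection of the
   cylinder sets pi_m^{-1}(pi_m S), so its measure is the infimum over m >= 1 of
   the measures of these cylinders. *)
Definition nu (R : realType) (S : cub -> Prop) : R :=
  inf [set r : R | exists m : nat, (0 < m)%N /\
     r = (3%:R)^-1 * (\sum_(t <- [:: (-1)%R; 0%R; 1%R]) (nres S t m)%:R)
         / (m%:R ^+ 2)].

(* Main.v *)
Require Import Defs.
From HB Require Import structures.
From mathcomp Require Import all_boot all_order all_algebra all_field.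
From mathcomp Require Import boolp classical_sets reals.
From mathcomp Require Import complex.
From mathcomp Require Import zify ring lra.
Import Order.TTheory GRing.Theory Num.Theory.
Local Open Scope ring_scope.

(** For [disc f != 0] the integral closure of [Z[x]/(f)] has a basis
    [1, (x - rho)/q, psi], where [psi] has leading coefficient [1/(q^2 m)], and
    closure under multiplication forces, for some integer [r],
    [q | 3r + t], [q^2 m | f'(r)] and [q^3 m^2 | f(r)], with [ind f = q^3 m].
    Conversely such [(q, m, r)] give [q^3 m | ind f].  Hence [n | ind f] is a
    congruence condition on [f]; it is periodic in [B] modulo [n^2].  Moreover the
    number [c(A)] of admissible classes [B mod n^2] depends only on [A mod n]: if
    [A] is replaced by [A + p^k u], then [B |-> B - p^k u r] preserves [f(r)], and it
    is injective when [r] is attached to the largest possible power of [p] in [q].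
    Since [n^2 | disc f], also [c(A) <= 27 n].
    It remains to count: [|A| <= 3 Y^2], and for given [A] the bounds [|B| <= Y^3]
    and [|disc f| < X] confine [B] to two intervals of length
    [O(min(Y^3, sqrt X))].  The main term sums [c(A)] over classes of [A mod n],
    which gives the density; the rounding term uses [c(A) <= 27 n]. *)

(** * The local condition at a prime power *)

(** The delicate point is the [n] next to [Y ^+ 2]. The obvious period of the condition in A is n^2,
    and summing over classes of A mod n^2 would only give Y^2 + n^2. The set of admissible B can
    change within a class of A mod n, but its size does not; so only counts are compared, by an
    injection in each direction. Both uses of the discriminant rest on completing the square in B:
    27 disc = 4 (t^2 - 3 A)^3 - u(B)^2 with u(B) = 2 t^3 - 9 t A + 27 B. Modulo n^2 this is a
    quadratic congruence and yields 27 n; over the reals the sign of u separates the two intervals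
    for B. The density enters through a lower bound alone: the admissible classes fill at least
    their share of every cylinder, and [nu] is an infimum over cylinders. *)

Definition cubv (t A B r : int) : int := r ^+ 3 + t * r ^+ 2 + A * r + B.
Definition cubd (t A r : int) : int := 3 * r ^+ 2 + 2 * t * r + A.
Definition ppow (p i : nat) : int := (p ^ i)%N%:Z.

(* The case [q = p^i], [m = p^(k - 3 i)] of the overring conditions; the only
   way in which the subtraction truncates is [3 i = k + 1], where [q^3 m = p^(k+1)]. *)
Definition local_rep (p k : nat) (t A B : int) (i : nat) (r : int) : bool :=
  [&& (3 * i <= k.+1)%N, (ppow p i %| 3 * r + t)%Z,
      (ppow p (2 * i + (k - 3 * i)) %| cubd t A r)%Z &
      (ppow p (3 * i + 2 * (k - 3 * i)) %| cubv t A B r)%Z].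

Ltac nlia :=
  repeat match goal with
  | H : context [dvdz] |- _ => clear H
  | H : context [local_rep] |- _ => clear H
  | H : context [cubv] |- _ => clear H
  | H : context [cubd] |- _ => clear H
  | H : context [ppow] |- _ => clear H
  end; lia.

Lemma ppow_dvd p i j : (i <= j)%N -> (ppow p i %| ppow p j)%Z.
Proof. by move=> h; rewrite dvdzE /ppow !absz_nat dvdn_exp2l. Qed.

Lemma ppowD p i j : ppow p (i + j) = ppow p i * ppow p j.
Proof. by rewrite /ppow expnD PoszM. Qed.

Lemma dvdz_ppowW p i j x : (i <= j)%N -> (ppow p j %| x)%Z -> (ppow p i %| x)%Z.
Proof. by move=> h; apply: dvdz_trans; apply: ppow_dvd. Qed.

Lemma dvdzD d x y : (d %| x)%Z -> (d %| y)%Z -> (d %| x + y)%Z.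
Proof. by move=> h1 h2; apply: rpredD. Qed.

Lemma dvdzB d x y : (d %| x)%Z -> (d %| y)%Z -> (d %| x - y)%Z.
Proof. by move=> h1 h2; apply: rpredB. Qed.

(* For d = r1 - r2 the two Taylor expansions at r2 give
   p^e | s d + d^2 and p^e | 2 s d + 3 d^2, hence p^e | d^2 and p^e | s d. *)
Lemma local_rep_congr p k t A B i1 r1 i2 r2 : prime p -> (i1 <= i2)%N ->
  local_rep p k t A B i1 r1 -> local_rep p k t A B i2 r2 ->
  ~~ local_rep p k t A B i2.+1 r2 ->
  (ppow p (3 * i2 + 2 * (k - 3 * i2)) %| ppow p k * (r1 - r2))%Z.
Proof.
move=> pp le12 /and4P[k1 s1 d1 v1] /and4P[k2 s2 d2 v2] mx.
set d := r1 - r2; set s := 3 * r2 + t.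
have Ev : cubv t A B r1 - cubv t A B r2 = d * (cubd t A r2 + s * d + d ^+ 2).
  by rewrite /cubv /cubd /s /d; ring.
have Ed : cubd t A r1 - cubd t A r2 = 2 * (s * d) + 3 * d ^+ 2.
  by rewrite /cubd /s /d; ring.
have pcop x j : ~~ (p%:Z %| x)%Z -> coprimez (ppow p j) x.
  move=> nx; rewrite coprimezE /ppow absz_nat coprimeXl // prime_coprime //.
(* First the truncated case 3 i2 = k + 1: the modulus is p^(k+1), so only p | d is wanted, and it
   follows from p | d^3. *)
case: (leqP (3 * i2) k) => h; last first.
  have e3 : (3 * i2 = k.+1)%N by nlia.
  have -> : (k - 3 * i2 = 0)%N by nlia.
  rewrite muln0 addn0 e3 -addn1 ppowD; apply: dvdz_mul; first exact: dvdzz.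
  have kg : (0 < i2)%N by nlia.
  have pd3 : (p%:Z %| d ^+ 3)%Z.
    have q j x : (0 < j)%N -> (ppow p j %| x)%Z -> (p%:Z %| x)%Z.
      by move=> j0 /(dvdz_ppowW p 1 j x j0); rewrite /ppow expn1.
    have -> : d ^+ 3 = cubv t A B r1 - cubv t A B r2 - cubd t A r2 * d - s * d ^+ 2.
      by rewrite Ev; ring.
    apply: dvdzB; last by apply: dvdz_mulr; apply: (q i2).
    apply: dvdzB; last by apply: dvdz_mulr; apply: (q (2 * i2 + (k - 3 * i2))%N) => //; nlia.
    apply: dvdzB; first by apply: (q (3 * i1 + 2 * (k - 3 * i1))%N) => //; nlia.
    by apply: (q (3 * i2 + 2 * (k - 3 * i2))%N) => //; nlia.
  rewrite /ppow expn1; move: pd3; rewrite !dvdzE abszX absz_nat Euclid_dvdX //.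
  by case/andP.
have e1 : (2 * i1 + (k - 3 * i1) = k - i1)%N by nlia.
have e1' : (3 * i1 + 2 * (k - 3 * i1) = 2 * k - 3 * i1)%N by nlia.
have e2 : (2 * i2 + (k - 3 * i2) = k - i2)%N by nlia.
have e2' : (3 * i2 + 2 * (k - 3 * i2) = 2 * k - 3 * i2)%N by nlia.
rewrite e2'; rewrite e1 in d1; rewrite e1' in v1; rewrite e2 in d2; rewrite e2' in v2.
have -> : (2 * k - 3 * i2 = k + (k - 3 * i2))%N by nlia.
rewrite ppowD; apply: dvdz_mul; first exact: dvdzz.
have [d0|dn0] := eqVneq d 0; first by rewrite d0 dvdz0.
have absd : (0 < `|d|%N)%N by rewrite absz_gt0.
set dl := logn p `|d|%N.
(* Suppose v_p(d) = dl < k - 3 i2. Dividing the first Taylor expansion by d costs p^dl, and the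
   exponent left, 2 k - 3 i2 - dl, is still at least e = k - i2. *)
have [//|ndv] := boolP (ppow p (k - 3 * i2) %| d)%Z; exfalso.
have ltd : (dl < k - 3 * i2)%N.
  rewrite ltnNge; apply: contra ndv => h1.
  by rewrite dvdzE /ppow absz_nat pfactor_dvdn.
have [d' [Dd nd']] : exists d', d = ppow p dl * d' /\ ~~ (p%:Z %| d')%Z.
  have /dvdzP[d' Dd] : (ppow p dl %| d)%Z by rewrite dvdzE /ppow absz_nat pfactor_dvdn.
  exists d'; split; first by rewrite Dd mulrC.
  apply/negP => h1.
  have : (ppow p dl.+1 %| d)%Z.
    by rewrite -addn1 ppowD Dd mulrC; apply: dvdz_mul; rewrite ?dvdzz // /ppow expn1.
  by rewrite dvdzE /ppow absz_nat pfactor_dvdn // ltnn.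
have pn0 j : ppow p j != 0 by rewrite /ppow eqz_nat expn_eq0 negb_and -lt0n prime_gt0.
have E1 : (ppow p (k - i2) %| s * d + d ^+ 2)%Z.
  have h1 : (ppow p (2 * k - 3 * i2) %| d * (cubd t A r2 + s * d + d ^+ 2))%Z.
    by rewrite -Ev; apply: dvdzB => //; apply: (dvdz_ppowW p _ _ _ _ v1); nlia.
  have h2 : (ppow p (2 * k - 3 * i2 - dl) %| cubd t A r2 + s * d + d ^+ 2)%Z.
    have D : (2 * k - 3 * i2 = dl + (2 * k - 3 * i2 - dl))%N by nlia.
    move: h1; rewrite D ppowD {1}Dd -mulrA dvdz_mul2l // addKn Gauss_dvdzr //.
    exact: pcop.
  have -> : s * d + d ^+ 2 = (cubd t A r2 + s * d + d ^+ 2) - cubd t A r2 by ring.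
  by apply: dvdzB => //; apply: (dvdz_ppowW p _ _ _ _ h2); nlia.
have E2 : (ppow p (k - i2) %| 2 * (s * d) + 3 * d ^+ 2)%Z.
  by rewrite -Ed; apply: dvdzB => //; apply: (dvdz_ppowW p _ _ _ _ d1); nlia.
have E3 : (ppow p (k - i2) %| d ^+ 2)%Z.
  have -> : d ^+ 2 = (2 * (s * d) + 3 * d ^+ 2) - 2 * (s * d + d ^+ 2) by ring.
  by apply: dvdzB => //; apply: dvdz_mull.
have E4 : (ppow p (k - i2) %| s * d)%Z.
  have -> : s * d = (s * d + d ^+ 2) - d ^+ 2 by ring.
  exact: dvdzB.
have E5 : (ppow p (2 * i2 + 1) %| s)%Z.
  have D : (k - i2 = dl + (k - i2 - dl))%N by nlia.
  have h1 : (ppow p (k - i2 - dl) %| s)%Z.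
    move: E4; rewrite D ppowD Dd mulrCA dvdz_mul2l // addKn.
    by rewrite Gauss_dvdzl //; apply: pcop.
  by apply: (dvdz_ppowW p _ _ _ _ h1); nlia.
(* The gain in s makes i2 + 1 admissible with the same r2, against [mx], unless 3 (i2 + 1) > k + 1.
   In that case k = 3 i2 + 1, so dl = 0, while p | d^2. *)
case: (leqP (3 * i2.+1) k.+1) => h3.
  case/negP: mx; apply/and4P; split => //.
  - by apply: (dvdz_ppowW p _ _ _ _ E5); nlia.
  - by apply: (dvdz_ppowW p _ _ _ _ d2); nlia.
  - by apply: (dvdz_ppowW p _ _ _ _ v2); nlia.
have dl0 : dl = 0%N by nlia.
have : (p%:Z %| d ^+ 2)%Z.
  by have := dvdz_ppowW p 1 _ _ _ E3; rewrite /ppow expn1; apply; nlia.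
rewrite dvdzE abszX Euclid_dvdX // => /andP[h4 _].
by move: nd'; rewrite dvdzE; rewrite Dd dl0 /ppow mul1r in h4; rewrite h4.
Qed.

(** * Counting residue classes *)

Lemma coprime_ind (P : nat -> Prop) :
  P 1%N -> (forall p k, prime p -> P (p ^ k)%N) ->
  (forall a b, (0 < a)%N -> (0 < b)%N -> coprime a b -> P a -> P b -> P (a * b)%N) ->
  forall n, (0 < n)%N -> P n.
Proof.
move=> P1 Pp PM n; have [m] := ubnP n; elim: m n => // m IH n ltnm n0.
have [n1|n1] := leqP n 1; first by have -> : n = 1%N by lia.
have pp := pdiv_prime n1.
rewrite -(partnC (pdiv n) n0); apply: PM; rewrite ?part_gt0 ?coprime_partC //.
  by rewrite p_part; apply: Pp.
apply: IH; rewrite ?part_gt0 //; apply: leq_trans (_ : n <= m)%N; last by lia.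
rewrite -[X in (_ < X)%N](partnC (pdiv n) n0) ltn_Pmull ?part_gt0 //.
by rewrite p_part_gt1 mem_primes pp n0 pdiv_dvd.
Qed.

Definition periodic (N : nat) (P : pred int) :=
  forall x y, (N%:Z %| x - y)%Z -> P x = P y.

Definition count_res (N : nat) (P : pred int) : nat := \sum_(0 <= x < N) P x%:Z.

Lemma count_resE N P : count_res N P = #|[set x : 'I_N | P (x : nat)%:Z]|.
Proof. by rewrite /count_res big_mkord -sum1dep_card [RHS]big_mkcond /=; apply: eq_bigr => i _; case: (P _). Qed.

Lemma eq_count_res N P Q : P =1 Q -> count_res N P = count_res N Q.
Proof. by move=> e; apply: eq_bigr => i _; rewrite e. Qed.

Lemma leq_count_res N (P Q : pred int) : (forall x, P x -> Q x) -> (count_res N P <= count_res N Q)%N.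
Proof. by move=> h; apply: leq_sum => i _; case: (P _) (h i%:Z) => // ->. Qed.

Lemma sum_periodic (N j : nat) (h : nat -> nat) : (forall x, h (x + N)%N = h x) ->
  (\sum_(0 <= x < N * j) h x = j * \sum_(0 <= x < N) h x)%N.
Proof.
move=> hp; elim: j => [|j IH]; first by rewrite muln0 mul0n big_geq.
rewrite mulnS mulSn (big_cat_nat (n := N)) //= ?leq_addr //; congr addn.
rewrite -IH -{1}[N]add0n big_addn addnC addnK.
by apply: eq_bigr => i _.
Qed.

Lemma count_res_lift N j P : periodic N P -> count_res (N * j) P = (j * count_res N P)%N.
Proof.
move=> hp; apply: (sum_periodic N j (fun x => P x%:Z : nat)) => x.
by congr nat_of_bool; apply: hp; rewrite PoszD addrC addKr dvdzz.
Qed.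

Lemma absz_mod_lt N (x : int) : (0 < N)%N -> (`|(x %% N%:Z)%Z|%N < N)%N.
Proof. by move=> N0; have := ltz_mod x (d := N%:Z); have := modz_ge0 x (d := N%:Z); lia. Qed.

Lemma dvdz_small N (x y : nat) : (x < N)%N -> (y < N)%N -> (N%:Z %| x%:Z - y%:Z)%Z -> x = y.
Proof.
move=> hx hy; rewrite -eqz_mod_dvd !modz_small //; try by apply/andP; split; lia.
by move/eqP => [].
Qed.

Lemma count_res_inj N M (P Q : pred int) (g : int -> int) : (0 < M)%N -> periodic M Q ->
  (forall x, P x -> Q (g x)) ->
  (forall x y, P x -> P y -> (M%:Z %| g x - g y)%Z -> (N%:Z %| x - y)%Z) ->
  (count_res N P <= count_res M Q)%N.
Proof.
move=> M0 hQ PQ gi; rewrite !count_resE.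
pose F (x : 'I_N) : 'I_M := Ordinal (absz_mod_lt M (g (x : nat)%:Z) M0).
have FE x : (M%:Z %| (F x : nat)%:Z - g (x : nat)%:Z)%Z.
  rewrite /F /= gez0_abs ?modz_ge0 //; last by lia.
  by rewrite -eqz_mod_dvd modz_mod.
rewrite -(card_in_imset (f := F) (D := mem [set x : 'I_N | P (x : nat)%:Z])).
  apply: subset_leq_card; apply/fintype.subsetP => y /imsetP[x]; rewrite !inE => Px ->.
  by rewrite (hQ _ _ (FE x)) PQ.
move=> x y; rewrite !inE => Px Py e; apply/val_inj; apply: (dvdz_small N _ _ (ltn_ord x) (ltn_ord y)).
apply: gi => //.
have -> : g (x : nat)%:Z - g (y : nat)%:Z =
  ((F y : nat)%:Z - g (y : nat)%:Z) - ((F x : nat)%:Z - g (x : nat)%:Z) by rewrite e; ring.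
exact: dvdzB.
Qed.

Lemma dvdz_mul_coprime a b x : coprime a b -> 
  ((a * b)%N%:Z %| x)%Z = (a%:Z %| x)%Z && (b%:Z %| x)%Z.
Proof. by move=> h; rewrite !dvdzE !absz_nat Gauss_dvd. Qed.

Lemma count_res_mul a b (P Q : pred int) : (0 < a)%N -> (0 < b)%N -> coprime a b ->
  periodic a P -> periodic b Q ->
  count_res (a * b) (fun x => P x && Q x) = (count_res a P * count_res b Q)%N.
Proof.
move=> a0 b0 cab hP hQ; rewrite !count_resE -cardsX.
pose F (x : 'I_(a * b)) : 'I_a * 'I_b :=
  (Ordinal (ltn_pmod x a0), Ordinal (ltn_pmod x b0)).
have Fa (x : nat) : (a%:Z %| (x %% a)%N%:Z - x%:Z)%Z.
  by rewrite -eqz_mod_dvd modz_nat modn_mod -modz_nat.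
have Fb (x : nat) : (b%:Z %| (x %% b)%N%:Z - x%:Z)%Z.
  by rewrite -eqz_mod_dvd modz_nat modn_mod -modz_nat.
rewrite -(card_in_imset (f := F) (D := mem [set x : 'I_(a * b) | P (x : nat)%:Z && Q (x : nat)%:Z])).
  apply/eq_card => -[u v]; rewrite !inE /=; apply/imsetP/andP.
    case=> x; rewrite !inE => /andP[Px Qx] [-> ->] /=.
    by rewrite (hP _ _ (Fa x)) (hQ _ _ (Fb x)).
  case=> Pu Qv; set z := (chinese a b u v %% (a * b))%N.
  have zlt : (z < a * b)%N by rewrite ltn_mod muln_gt0 a0.
  have za : (z %% a)%N = u.
    by rewrite /z modn_dvdm ?dvdn_mulr // chinese_modl // modn_small.
  have zb : (z %% b)%N = v.
    by rewrite /z modn_dvdm ?dvdn_mull // chinese_modr // modn_small.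
  exists (Ordinal zlt); last by congr pair; apply/val_inj => /=; rewrite ?za ?zb.
  by rewrite inE /= -(hP _ _ (Fa z)) -(hQ _ _ (Fb z)) za zb Pu.
move=> x y _ _ [ea eb]; apply/val_inj; apply: (dvdz_small (a * b) _ _ (ltn_ord x) (ltn_ord y)).
rewrite dvdz_mul_coprime // -!eqz_mod_dvd !modz_nat ea eb.
by rewrite !eqxx.
Qed.

Lemma count_res_dvd d j (g : int) : (0 < d)%N -> (count_res (d * j) (fun x => (d%:Z %| (x + g)%R)%Z) <= j)%N.
Proof.
move=> d0; rewrite count_res_lift; last first.
  move=> x y h; apply/idP/idP => h'.
    by have -> : y + g = (x + g) - (x - y) by [ring]; apply: dvdzB.
  by have -> : x + g = (y + g) + (x - y) by [ring]; apply: dvdzD.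
rewrite -[X in (_ <= X)%N]muln1 leq_mul2l; apply/orP; right.
rewrite count_resE; apply/card_le1_eqP => x y; rewrite !inE => h1 h2.
apply/esym/val_inj; apply: (dvdz_small d _ _ (ltn_ord x) (ltn_ord y)).
by have -> : (x : nat)%:Z - (y : nat)%:Z = ((x : nat)%:Z + g) - ((y : nat)%:Z + g) by [ring]; apply: dvdzB.
Qed.

(** For n = p^k with p^k | b, the congruence forces p^k | x, which leaves p^k classes. Otherwise let
    a = v_p(b) < k: x and x + b are not both divisible by p^(a+1), so one of them is divisible by
    p^(2k-a), which leaves at most 2 p^a <= p^(a+1) <= p^k classes. *)
Lemma count_res_quadratic n b : (0 < n)%N ->
  (count_res (n ^ 2) (fun x => ((n ^ 2)%N%:Z %| (x * (x + b))%R)%Z) <= n)%N.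
Proof.
have per N : periodic N (fun x => (N%:Z %| x * (x + b))%Z).
  move=> x y h; apply/idP/idP => h'.
    by have -> : y * (y + b) = x * (x + b) - (x - y) * (x + y + b) by [ring]; apply: dvdzB => //; apply: dvdz_mulr.
  by have -> : x * (x + b) = y * (y + b) + (x - y) * (x + y + b) by [ring]; apply: dvdzD => //; apply: dvdz_mulr.
move: n; apply: coprime_ind; first by rewrite exp1n /count_res big_nat1; case: (_ %| _)%Z.
- move=> p k pp; have p0 := prime_gt0 pp.
  rewrite -expnM muln2 -addnn.
  have [kb|nb] := boolP (ppow p k %| b)%Z.
    rewrite [in X in (count_res X _ <= _)%N]expnD; apply: leq_trans (count_res_dvd (p ^ k) (p ^ k) 0 _); last by rewrite expn_gt0 p0.
    apply: leq_count_res => x; rewrite addr0 -[X in (X %| _)%Z]/(ppow p _) -[X in _ -> (X %| _)%Z]/(ppow p _) => h.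
    have [//|nx] := boolP (ppow p k %| x)%Z; exfalso.
    have x0 : x != 0 by apply: contra nx => /eqP->; rewrite dvdz0.
    have xb : x + b != 0.
      apply: contra nx => /eqP e; have -> : x = (x + b) - b by ring.
      by rewrite e sub0r dvdzE abszN -dvdzE.
    move: h nx; rewrite /ppow !dvdzE !absz_nat abszM.
    rewrite !pfactor_dvdn ?muln_gt0 ?absz_gt0 ?x0 // lognM ?absz_gt0 // -ltnNge => h nx.
    have : (k <= logn p `|(x + b)%R|)%N by lia.
    rewrite -pfactor_dvdn ?absz_gt0 // => hb.
    have : (ppow p k %| x)%Z.
      have -> : x = (x + b) - b by ring.
      by apply: dvdzB => //; rewrite dvdzE absz_nat.
    by rewrite dvdzE absz_nat pfactor_dvdn ?absz_gt0 // leqNgt nx.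
  have b0 : b != 0 by apply: contra nb => /eqP->; rewrite dvdz0.
  move: (nb); rewrite dvdzE absz_nat pfactor_dvdn ?absz_gt0 // -ltnNge.
  set a := logn p `|b|%N => ak.
  have E : (p ^ (k + k) = p ^ (k + k - a) * p ^ a)%N by rewrite -expnD subnK //; lia.
  apply: (@leq_trans (p ^ a + p ^ a)); last first.
    rewrite addnn -mul2n; apply: (@leq_trans (p * p ^ a)).
      by rewrite leq_mul2r (prime_gt1 pp) orbT.
    by rewrite -expnS leq_pexp2l.
  pose d := (p ^ (k + k - a))%N.
  apply: (@leq_trans (count_res (d * p ^ a) (fun x => (d%:Z %| (x + 0)%R)%Z) +
                     count_res (d * p ^ a) (fun x => (d%:Z %| (x + b)%R)%Z))%N); last first.
    by apply: leq_add; apply: count_res_dvd; rewrite expn_gt0 p0.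
  rewrite /count_res -E -big_split /=; apply: leq_sum => x _; rewrite addr0.
  set y := x%:Z; move: {x} y => x.
  have [h|//] := boolP ((p ^ (k + k))%N%:Z %| x * (x + b))%Z.
  have [//|nx] := boolP (d%:Z %| x)%Z; rewrite add0n.
  have [//|nxb] := boolP (d%:Z %| x + b)%Z; exfalso.
  have x0 : x != 0 by apply: contra nx => /eqP->; rewrite dvdz0.
  have xb : x + b != 0 by apply: contra nxb => /eqP->; rewrite dvdz0.
  move: h nx nxb; rewrite /d !dvdzE !absz_nat abszM.
  rewrite !pfactor_dvdn ?muln_gt0 ?absz_gt0 ?x0 // lognM ?absz_gt0 // -!ltnNge => h nx nxb.
  have h1 : (a.+1 <= logn p `|x|)%N by lia.
  have h2 : (a.+1 <= logn p `|(x + b)%R|)%N by lia.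
  have : (ppow p a.+1 %| b)%Z.
    have -> : b = (x + b) - x by ring.
    by apply: dvdzB; rewrite dvdzE absz_nat pfactor_dvdn ?absz_gt0.
  by rewrite dvdzE absz_nat pfactor_dvdn ?absz_gt0 // ltnn.
- move=> m n m0 n0 cmn Im In.
  apply: leq_trans (leq_mul Im In).
  rewrite -count_res_mul ?expn_gt0 ?m0 ?n0 ?coprimeXl ?coprimeXr //.
  rewrite expnMn; apply: leq_count_res => x /=.
  by rewrite dvdz_mul_coprime // coprimeXl ?coprimeXr.
Qed.

(** * Invariance of the number of admissible classes *)

Definition local_cond (p k : nat) (t A B : int) : bool :=
  `[< exists i r, local_rep p k t A B i r >].

Definition index_cond (n : nat) (t A B : int) : bool :=
  all (fun p => local_cond p (logn p n) t A B) (primes n).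

Lemma local_rep_periodic p k t A B B' i r :
  (ppow p (3 * i + 2 * (k - 3 * i)) %| B - B')%Z ->
  local_rep p k t A B i r = local_rep p k t A B' i r.
Proof.
move=> h; congr [&& _, _, _ & _]; apply/idP/idP => h'.
  have -> : cubv t A B' r = cubv t A B r - (B - B') by rewrite /cubv; ring.
  exact: dvdzB.
have -> : cubv t A B r = cubv t A B' r + (B - B') by rewrite /cubv; ring.
exact: dvdzD.
Qed.

(** The exponent 3 i + 2 (k - 3 i) never exceeds 2 k, even when the subtraction truncates, since 3 i
    = k + 1 forces k >= 2. *)
Lemma local_cond_periodic p k t A : periodic (p ^ (2 * k)) (local_cond p k t A).
Proof.
move=> x y h; apply: asbool_equiv_eq; split=> -[i [r hr]]; exists i, r.
  rewrite -(local_rep_periodic _ _ _ _ x) //; apply: (dvdz_ppowW p _ (2 * k)) => //.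
  by case/and4P: hr; nlia.
rewrite (local_rep_periodic _ _ _ _ _ y) //; apply: (dvdz_ppowW p _ (2 * k)) => //.
by case/and4P: hr; nlia.
Qed.

Lemma local_cond_max p k t A B : local_cond p k t A B ->
  exists i, (exists r, local_rep p k t A B i r) /\ (forall j r, local_rep p k t A B j r -> (j <= i)%N).
Proof.
move=> /asboolP[i0 h0].
pose P i := `[< exists r, local_rep p k t A B i r >].
have exP : exists i, P i by exists i0; apply/asboolP.
have bP i : P i -> (i <= k.+1)%N by move=> /asboolP[r /and4P[+ _ _ _]]; nlia.
have [i /asboolP Pi mi] := ex_maxnP exP bP.
exists i; split=> // j r h; apply: mi.
by apply/asboolP; exists r.
Qed.

(** Besides preserving f(r), the shift moves f'(r) by p^k u, which is harmless because 2 i + (k - 3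
    i) <= k. *)
Lemma local_rep_shift p k t A B i r u : local_rep p k t A B i r ->
  local_rep p k t (A + ppow p k * u) (B - ppow p k * u * r) i r.
Proof.
case/and4P=> h1 h2 h3 h4; apply/and4P; split=> //.
  have -> : cubd t (A + ppow p k * u) r = cubd t A r + ppow p k * u by rewrite /cubd; ring.
  by apply: dvdzD => //; apply: dvdz_mulr; apply: ppow_dvd; nlia.
by have -> : cubv t (A + ppow p k * u) (B - ppow p k * u * r) r = cubv t A B r
  by [rewrite /cubv; ring].
Qed.

(* [rho] picks [r] from the set of all admissible [r] for the maximal [i], so two
   residues lying in the same maximal box receive the same shift. *)
Lemma local_cond_shift p k t A u : prime p ->
  (count_res (p ^ (2 * k)) (local_cond p k t A) <=
   count_res (p ^ (2 * k)) (local_cond p k t (A + ppow p k * u)))%N.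
Proof.
move=> pp; have p0 := prime_gt0 pp.
have [rho hrho] : exists rho : pred int -> int,
    forall S : pred int, (exists r, S r) -> S (rho S).
  have /choice[rho h] : forall S : pred int, exists r, (exists r, S r) -> S r; last by exists rho.
  move=> S; case: (pselect (exists r, S r)) => [[r hr]|n]; first by exists r.
  by exists 0 => h; case: n.
have [iota hiota] : exists iota : int -> nat, forall B, local_cond p k t A B ->
    (exists r, local_rep p k t A B (iota B) r) /\ (forall j r, local_rep p k t A B j r -> (j <= iota B)%N).
  have /choice[io h] : forall B, exists i, local_cond p k t A B ->
    (exists r, local_rep p k t A B i r) /\ (forall j r, local_rep p k t A B j r -> (j <= i)%N); last by exists io.
  move=> B; case: (boolP (local_cond p k t A B)) => [/local_cond_max[i hi]|nh]; first by exists i.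
  by exists 0%N.
pose r B := rho (fun r => local_rep p k t A B (iota B) r).
have hr B : local_cond p k t A B -> local_rep p k t A B (iota B) (r B).
  by move=> /hiota[h _]; exact: (hrho _ h).
pose g B := B - ppow p k * u * r B.
apply: (count_res_inj _ _ _ _ g); first by rewrite expn_gt0 p0.
- exact: local_cond_periodic.
- by move=> B /hr h; apply/asboolP; exists (iota B), (r B); exact: local_rep_shift.
have main x y : local_cond p k t A x -> local_cond p k t A y -> (iota x <= iota y)%N ->
    (ppow p (2 * k) %| g x - g y)%Z -> (ppow p (2 * k) %| x - y)%Z.
  move=> Wx Wy le hg; have [Rx Ry] := (hr _ Wx, hr _ Wy).
  have [_ mx] := hiota _ Wx; have [_ my] := hiota _ Wy.
  have le2' A' B' i r' : local_rep p k t A' B' i r' -> (3 * i + 2 * (k - 3 * i) <= 2 * k)%N.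
    by case/and4P => h *; nlia.
  have le2 := le2' A y.
  (* After the shift both representations belong to the same pair (A + p^k u, g x), so
     [local_rep_congr] can compare r x with r y. *)
  have Sx := local_rep_shift _ _ _ _ _ _ _ u Rx.
  have := local_rep_shift _ _ _ _ _ _ _ u Ry.
  rewrite -/(g y) -(local_rep_periodic _ _ _ _ (g x)); last first.
    by apply: (dvdz_ppowW p _ (2 * k)) => //; exact: (le2 _ _ Ry).
  move=> Sy.
  (* Shifting back by - u would turn such a representation into one of (A, y) with exponent iota y +
     1, against maximality. *)
  have nSy : ~~ local_rep p k t (A + ppow p k * u) (g x) (iota y).+1 (r y).
    apply/negP => F; have := local_rep_shift _ _ _ _ _ _ _ (- u) F.
    have -> : A + ppow p k * u + ppow p k * - u = A by ring.
    move=> F'; have /= := my (iota y).+1 (r y); rewrite ltnn => G; apply/notF/G.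
    rewrite -(local_rep_periodic _ _ _ _ (g x - ppow p k * - u * r y)) //.
    have -> : g x - ppow p k * - u * r y - y = g x - g y by rewrite /g; ring.
    by apply: (dvdz_ppowW p _ (2 * k)) => //; exact: (le2' _ _ _ _ F').
  have dr := local_rep_congr _ _ _ _ _ _ _ _ _ pp le Sx Sy nSy.
  have dxy : (ppow p (3 * iota y + 2 * (k - 3 * iota y)) %| x - y)%Z.
    have -> : x - y = (g x - g y) + ppow p k * (r x - r y) * u by rewrite /g; ring.
    apply: dvdzD; last exact: dvdz_mulr.
    by apply: (dvdz_ppowW p _ (2 * k)) => //; exact: (le2 _ _ Ry).
  (* Since x and y agree to the precision seen by exponent iota y, they have the same maximal
     exponent and the same set of admissible r; [rho] then gives r x = r y, and both were shifted by
     the same amount. *)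
  have Rxy : local_rep p k t A x (iota y) (r y) by rewrite (local_rep_periodic _ _ _ _ _ y).
  have e : iota x = iota y.
    by apply/eqP; rewrite eqn_leq le (mx _ _ Rxy).
  have er : r x = r y.
    congr rho; apply/funext => r'; rewrite e; exact: local_rep_periodic.
  by have -> : x - y = g x - g y by rewrite /g er; ring.
move=> x y Wx Wy h; case/orP: (leq_total (iota x) (iota y)) => le; first exact: main.
rewrite -opprB dvdzE abszN -dvdzE; apply: main => //.
by rewrite -opprB dvdzE abszN -dvdzE.
Qed.

(* If [3 i > k + 1], the exponent [(k + 1) / 3] already works with the same [r]. *)
Lemma local_cond_of_overring p k t A B i l r : (k <= 3 * i + l)%N ->
  (ppow p i %| 3 * r + t)%Z -> (ppow p (2 * i + l) %| cubd t A r)%Z ->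
  (ppow p (3 * i + 2 * l) %| cubv t A B r)%Z -> local_cond p k t A B.
Proof.
move=> h h1 h2 h3; apply/asboolP; have [le|gt] := leqP (3 * i) k.+1.
  exists i, r; apply/and4P; split=> //; first by apply: (dvdz_ppowW _ _ _ _ _ h2); nlia.
  by apply: (dvdz_ppowW _ _ _ _ _ h3); nlia.
exists (k.+1 %/ 3)%N, r; apply/and4P; split; first by nlia.
- by apply: (dvdz_ppowW _ _ _ _ _ h1); nlia.
- by apply: (dvdz_ppowW _ _ _ _ _ h2); nlia.
- by apply: (dvdz_ppowW _ _ _ _ _ h3); nlia.
Qed.

(** * From prime powers to arbitrary n *)

Lemma index_cond1 t A B : index_cond 1 t A B.
Proof. by []. Qed.

Lemma local_cond0 p t A B : local_cond p 0 t A B.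
Proof.
by apply: (local_cond_of_overring p 0 t A B 0 0 0); rewrite // /ppow expn0 dvd1z.
Qed.

Lemma index_cond_pfactor p k t A B : prime p -> index_cond (p ^ k) t A B = local_cond p k t A B.
Proof.
case: k => [|k] pp; first by rewrite expn0 index_cond1 local_cond0.
by rewrite /index_cond primesX // primes_prime //= andbT pfactorK.
Qed.

Lemma index_cond_mul a b t A B : (0 < a)%N -> (0 < b)%N -> coprime a b ->
  index_cond (a * b) t A B = index_cond a t A B && index_cond b t A B.
Proof.
move=> a0 b0 cab.
have la p : p \in primes a -> logn p (a * b) = logn p a.
  rewrite mem_primes => /and3P[pp _ pa]; rewrite lognM // [logn p b]lognE.
  case: ifP; rewrite ?addn0 // => /and3P[_ _ pb].
  have : (p %| gcdn a b)%N by rewrite dvdn_gcd pa.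
  by rewrite (eqP cab) dvdn1 => /eqP p1; rewrite p1 in pp.
have lb p : p \in primes b -> logn p (a * b) = logn p b.
  rewrite mem_primes => /and3P[pp _ pb]; rewrite lognM // [logn p a]lognE.
  case: ifP; rewrite ?add0n // => /and3P[_ _ pa].
  have : (p %| gcdn a b)%N by rewrite dvdn_gcd pa.
  by rewrite (eqP cab) dvdn1 => /eqP p1; rewrite p1 in pp.
apply/allP/andP => [h|[/allP ha /allP hb] p].
  split; apply/allP => p hp.
    by rewrite -(la p) //; apply: h; rewrite primesM // hp.
  by rewrite -(lb p) //; apply: h; rewrite primesM // hp orbT.
by rewrite primesM // => /orP[] hp; [rewrite la|rewrite lb] => //; [apply: ha|apply: hb].
Qed.

Lemma index_cond_periodic n t A : (0 < n)%N -> periodic (n ^ 2) (index_cond n t A).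
Proof.
move: n; apply: coprime_ind => [x y _|p k pp x y|a b a0 b0 cab Ha Hb x y].
- by rewrite !index_cond1.
- by rewrite !index_cond_pfactor // -expnM mulnC; apply: local_cond_periodic.
- rewrite !index_cond_mul // expnMn dvdz_mul_coprime; last by rewrite coprimeXl // coprimeXr.
  by move=> /andP[h1 h2]; rewrite (Ha x y) // (Hb x y).
Qed.

Lemma index_cond_shift n t A u : (0 < n)%N ->
  (count_res (n ^ 2) (index_cond n t A) <= count_res (n ^ 2) (index_cond n t (A + n%:Z * u)))%N.
Proof.
move=> n0; move: n n0 A u; apply: coprime_ind => [A u|p k pp A u|a b a0 b0 cab Ha Hb A u].
- by apply: leq_count_res => x; rewrite !index_cond1.
- have e := fun A => eq_count_res (p ^ (2 * k)) _ _ (fun B => index_cond_pfactor p k t A B pp).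
  by rewrite -expnM mulnC !e; apply: local_cond_shift.
- have e := fun A => eq_count_res ((a * b) ^ 2) _ _ (fun B => index_cond_mul a b t A B a0 b0 cab).
  rewrite !e expnMn !count_res_mul ?expn_gt0 ?a0 ?b0 //; try exact: index_cond_periodic; try by rewrite coprimeXl // coprimeXr.
  apply: leq_mul.
    by have := Ha A (b%:Z * u); rewrite mulrA -PoszM.
  by have := Hb A (a%:Z * u); rewrite mulrA -PoszM mulnC.
Qed.

Lemma index_cond_count_eq n t A A' : (0 < n)%N -> (n%:Z %| A - A')%Z ->
  count_res (n ^ 2) (index_cond n t A) = count_res (n ^ 2) (index_cond n t A').
Proof.
move=> n0 /dvdzP[u hu]; apply/eqP; rewrite eqn_leq; apply/andP; split.
  have -> : A' = A + n%:Z * - u by rewrite mulrN mulrC -hu; ring.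
  exact: index_cond_shift.
have -> : A = A' + n%:Z * u by rewrite mulrC -hu; ring.
exact: index_cond_shift.
Qed.

(** Here f(x + r) = x^3 + s x^2 + d x + v, and the discriminant is invariant under translation. *)
Lemma disc_taylor t A B r : let s := 3 * r + t in let d := cubd t A r in
  let v := cubv t A B r in
  disc (t, A, B) = s ^+ 2 * d ^+ 2 - 4 * d ^+ 3 - 4 * s ^+ 3 * v - 27 * v ^+ 2
     + 18 * s * d * v.
Proof. by rewrite /disc /cub_t /cub_A /cub_B /cubd /cubv /=; ring. Qed.

(** With l = k - 3 i, the coefficients s, d, v are divisible by p to the powers i, 2 i + l, 3 i + 2
    l, so each of the five monomials of the discriminant is divisible by p^(6 i + 2 l), and 3 i + l
    >= k. *)
Lemma local_cond_disc p k t A B : local_cond p k t A B -> (ppow p (2 * k) %| disc (t, A, B))%Z.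
Proof.
move=> /asboolP[i [r /and4P[h1 h2 h3 h4]]]; rewrite (disc_taylor t A B r) /=.
move: h2 h3 h4; set l := (k - 3 * i)%N; set s := 3 * r + t.
have kl : (k <= 3 * i + l)%N by rewrite /l; lia.
move=> /dvdzP[s' ->] /dvdzP[d' ->] /dvdzP[v' ->].
apply: (dvdz_ppowW p _ (2 * (3 * i + l))); first by lia.
have -> : ppow p (2 * i + l) = ppow p i ^+ 2 * ppow p l.
  by rewrite mul2n -addnn !ppowD -expr2.
have -> : ppow p (3 * i + 2 * l) = ppow p i ^+ 3 * ppow p l ^+ 2.
  rewrite (_ : (3 * i + 2 * l = i + i + i + (l + l))%N); last by lia.
  by rewrite !ppowD; ring.
have -> : ppow p (2 * (3 * i + l)) = ppow p i ^+ 6 * ppow p l ^+ 2.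
  rewrite (_ : (2 * (3 * i + l) = i + i + i + i + i + i + (l + l))%N); last by lia.
  by rewrite !ppowD; ring.
apply/dvdzP; exists (s' ^+ 2 * d' ^+ 2 - 4 * d' ^+ 3 * ppow p l - 4 * s' ^+ 3 * v'
  - 27 * v' ^+ 2 * ppow p l ^+ 2 + 18 * s' * d' * v' * ppow p l).
ring.
Qed.

Lemma index_cond_disc n t A B : (0 < n)%N -> index_cond n t A B -> ((n ^ 2)%N%:Z %| disc (t, A, B))%Z.
Proof.
move: n; apply: coprime_ind => [_|p k pp|a b a0 b0 cab Ha Hb].
- by rewrite exp1n dvd1z.
- by rewrite index_cond_pfactor // -expnM mulnC; apply: local_cond_disc.
- rewrite index_cond_mul // expnMn dvdz_mul_coprime; last by rewrite coprimeXl // coprimeXr.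
  by move=> /andP[/Ha-> /Hb->].
Qed.

(** Fix one admissible B0. As 27 disc + u(B)^2 is independent of B, every admissible x gives y = 27
    (x - B0) with n^2 | y (y + 2 u(B0)). Multiplication by 27 injects classes mod n^2 into classes
    mod 27 n^2, also when 3 | n, and for that modulus the congruence has at most 27 n solutions. *)
Lemma count_index_cond_le n t A : (0 < n)%N -> (count_res (n ^ 2) (index_cond n t A) <= 27 * n)%N.
Proof.
move=> n0; have n20 : (0 < n ^ 2)%N by rewrite expn_gt0 n0.
case: (pselect (exists B, index_cond n t A B)) => [[B0 W0]|nW]; last first.
  apply: (@leq_trans (count_res (n ^ 2) pred0)).
    by apply: leq_count_res => x h; case: nW; exists x.
  by rewrite /count_res big1.
pose u := 2 * t ^+ 3 - 9 * t * A + 27 * B0.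
pose P (x : int) := ((n ^ 2)%N%:Z %| x * (x + 2 * u))%Z.
have perP : periodic (n ^ 2) P.
  move=> x y h; apply/idP/idP => h'; rewrite /P.
    have -> : y * (y + 2 * u) = x * (x + 2 * u) - (x - y) * (x + y + 2 * u) by ring.
    by apply: dvdzB => //; apply: dvdz_mulr.
  have -> : x * (x + 2 * u) = y * (y + 2 * u) + (x - y) * (x + y + 2 * u) by ring.
  by apply: dvdzD => //; apply: dvdz_mulr.
apply: leq_trans (leq_mul (leqnn 27) (count_res_quadratic n (2 * u) n0)).
rewrite -count_res_lift //; apply: (count_res_inj _ _ _ _ (fun x => 27 * (x - B0))).
- by rewrite muln_gt0 n20.
- move=> x y h; apply: perP; apply: dvdz_trans h.
  by rewrite dvdzE !absz_nat dvdn_mulr.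
- move=> x /(index_cond_disc _ _ _ _ n0) hx; rewrite /P.
  have -> : 27 * (x - B0) * (27 * (x - B0) + 2 * u) =
      27 * (disc (t, A, B0) - disc (t, A, x)).
    by rewrite /u /disc /cub_t /cub_A /cub_B /=; ring.
  by apply: dvdz_mull; apply: dvdzB => //; apply: index_cond_disc.
- move=> x y _ _; have -> : 27 * (x - B0) - 27 * (y - B0) = 27 * (x - y) by ring.
  by rewrite mulnC PoszM dvdz_mul2l.
Qed.

(** * Lattices in Q^3 *)

(** The least positive n/D in H generates H, by division with remainder; since 1 is a multiple of
    it, it has the form 1/a. *)
Lemma rat_subgroup_cyclic (H : rat -> Prop) (D : nat) : (0 < D)%N ->
  (forall x y, H x -> H y -> H (x - y)) -> H 1 ->
  (forall x, H x -> x * D%:R \is a Num.int) ->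
  exists2 a : nat, (0 < a)%N &
    H (a%:R^-1) /\ (forall x, H x -> x * a%:R \is a Num.int).
Proof.
move=> D0 HB H1 HD.
have H0 : H 0 by rewrite -(subrr 1); apply: HB.
have HN x : H x -> H (- x) by move=> h; rewrite -sub0r; apply: HB.
have HA x y : H x -> H y -> H (x + y).
  by move=> hx hy; rewrite -[y]opprK; apply: HB => //; apply: HN.
have HMn x n : H x -> H (x *+ n).
  by move=> hx; elim: n => [|n IH]; rewrite ?mulr0n // mulrSr; apply: HA.
have HM x (n : int) : H x -> H (x *~ n).
  move=> hx; case: n => n; first exact: HMn.
  by rewrite NegzE mulrNz; apply: HN; apply: HMn.
have Dr : D%:R != 0 :> rat by rewrite pnatr_eq0 -lt0n.
pose P n := (0 < n)%N && `[< H (n%:R / D%:R) >].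
have exP : exists n, P n.
  by exists D; rewrite /P D0; apply/asboolP; rewrite divff.
case: (ex_minnP exP) => n /andP[n0 /asboolP Hn] mn.
have key x : H x -> exists y : int, x = (n%:R / D%:R) *~ y.
  move=> hx; have /intrP[y hy] := HD _ hx.
  exists (y %/ n%:Z)%Z; pose r := `|(y %% n%:Z)%Z|%N.
  have rE : r%:Z = (y %% n%:Z)%Z by rewrite gez0_abs // modz_ge0 //; lia.
  have rn : (r < n)%N by rewrite -ltz_nat rE ltz_pmod //; lia.
  have Ey : y%:~R = (y %/ n%:Z)%Z%:~R * n%:R + r%:R :> rat.
    rewrite [in LHS](divz_eq y n%:Z) rmorphD rmorphM /= -!pmulrn.
    by rewrite -rE -pmulrn.
  have E : x - (n%:R / D%:R) *~ (y %/ n%:Z)%Z = r%:R / D%:R.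
    apply: (mulIf Dr); rewrite divfK // mulrBl hy Ey -[n%:R / _ *~ _]mulrzr.
    by rewrite [n%:R / _ * _]mulrAC divfK //; ring.
  have Hr : H (r%:R / D%:R) by rewrite -E; apply: HB => //; apply: HM.
  have [r0|r0] := posnP r; first by apply/eqP; rewrite -subr_eq0 E r0 mul0r.
  have : P r by rewrite /P r0; apply/asboolP.
  by move=> /mn; rewrite leqNgt rn.
have [a ha] := key 1 H1.
have nr : n%:R != 0 :> rat by rewrite pnatr_eq0 -lt0n.
have Da : D%:R = n%:R * a%:~R :> rat.
  by apply: (mulfI (invr_neq0 Dr)); rewrite mulVf // [LHS]ha -[n%:R / _ *~ _]mulrzr; ring.
have a0 : (0 < a).
  rewrite -(ltr0z rat) -(pmulr_rgt0 _ (x := n%:R)) ?ltr0n // -Da ltr0n //.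
have aE : (`|a|%N)%:R = a%:~R :> rat by rewrite pmulrn gtz0_abs.
have ar : a%:~R != 0 :> rat by rewrite intr_eq0 gt_eqF.
have E : (a%:~R)^-1 = n%:R / D%:R :> rat by rewrite Da invfM mulrA divff // mul1r.
exists `|a|%N; first by rewrite absz_gt0 gt_eqF.
rewrite aE; split; first by rewrite E.
move=> x /key[y ->]; rewrite -E -mulrzr mulrAC mulVf // mul1r.
exact: intr_int.
Qed.

Definition fracr (x : rat) : rat := x - (Num.floor x)%:~R.

Definition frac3 (c : rat * rat * rat) : rat * rat * rat :=
  (fracr c.1.1, fracr c.1.2, fracr c.2).

Lemma fracr_itv x : 0 <= fracr x < 1.
Proof. by rewrite /fracr subr_ge0 floor_le ltrBlDl; have := floorD1_gt x; rewrite rmorphD. Qed.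

Lemma fracr_id x : 0 <= x < 1 -> fracr x = x.
Proof.
move=> /andP[h0 h1]; rewrite /fracr (_ : Num.floor x = 0) ?subr0 //.
by apply: floor_def; rewrite add0r h0 h1.
Qed.

Lemma fracrDint x (z : int) : fracr (x + z%:~R) = fracr x.
Proof. 
rewrite /fracr (_ : Num.floor (x + _) = Num.floor x + z); first by rewrite rmorphD /=; ring.
apply: floor_def; rewrite -addrA [z + 1]addrC addrA !(rmorphD _ _ z) /=.
by rewrite lerD2r ltrD2r floor_le floorD1_gt. Qed.

Lemma divn_int_inj (a j k : nat) : (j < a)%N -> (k < a)%N ->
  j%:R / a%:R - k%:R / a%:R \is a @Num.int rat -> j = k.
Proof.
move=> ja ka /intrP[z hz].
have ar : a%:R != 0 :> rat by rewrite pnatr_eq0; lia.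
have : (j%:Z - k%:Z)%:~R = (z * a%:Z)%:~R :> rat.
  rewrite rmorphM rmorphB /= -!pmulrn -hz mulrBl !divfK //.
by move/intr_inj => e; apply: (dvdz_small a) => //; rewrite e dvdz_mull.
Qed.

(** This is a triangular (Hermite) basis (1, 0, 0), (x0, 1/q, 0), (y0, y1, 1/a): each diagonal entry
    generates a cyclic group of rationals. The combinations with coefficients i < q and j < a,
    reduced modulo Z^3, meet each class of L / Z^3 exactly once, whence q a points in the unit
    cube. *)
Lemma lattice_hermite (L : rat * rat * rat -> Prop) (D : nat) : (0 < D)%N ->
  (forall c d, L c -> L d -> L (c - d)) ->
  (forall a b c : int, L (a%:~R, b%:~R, c%:~R)) ->
  (forall x, L (x, 0, 0) -> x \is a Num.int) ->
  (forall c, L c -> c.1.2 * D%:R \is a Num.int /\ c.2 * D%:R \is a Num.int) ->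
  exists (q a : nat) (x0 y0 y1 : rat), [/\ (0 < q)%N, (0 < a)%N,
    L (x0, q%:R^-1, 0) & L (y0, y1, a%:R^-1)] /\
    [/\ forall x y, L (x, y, 0) -> y * q%:R \is a Num.int,
        forall c, L c -> c.2 * a%:R \is a Num.int &
        exists s : seq (rat * rat * rat), [/\ uniq s, size s = (q * a)%N &
          forall c, c \in s <-> (in_unit_cube c /\ L c)]].
Proof.
move=> D0 LB LZ L0 LD.
have Lz : L 0 by have := LZ 0 0 0.
have LN c : L c -> L (- c) by move=> h; rewrite -sub0r; apply: LB.
have LA c d : L c -> L d -> L (c + d).
  by move=> hx hy; rewrite -[d]opprK; apply: LB => //; apply: LN.
have LMn c n : L c -> L (c *+ n).
  by move=> hx; elim: n => [|n IH]; rewrite ?mulr0n // mulrSr; apply: LA.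
have LM c (n : int) : L c -> L (c *~ n).
  move=> hx; case: n => n; first exact: LMn.
  by rewrite NegzE mulrNz; apply: LN; apply: LMn.
have [q q0 [[x0 Hq] Mq]] : exists2 q : nat, (0 < q)%N &
    (exists x, L (x, q%:R^-1, 0)) /\
    (forall y, (exists x, L (x, y, 0)) -> y * q%:R \is a Num.int).
  apply: (rat_subgroup_cyclic (fun y => exists x, L (x, y, 0)) D) => //.
  - move=> y y' [x h] [x' h']; exists (x - x'); have := LB _ _ h h'.
    by rewrite -[(_, _) - _]/(x - x', y - y', 0 - 0) subr0.
  - by exists 0; have := LZ 0 1 0.
  - by move=> y [x /LD []].
have [a a0 [[y0 [y1 Ha]] Ma]] : exists2 a : nat, (0 < a)%N &
    (exists x y, L (x, y, a%:R^-1)) /\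
    (forall z, (exists x y, L (x, y, z)) -> z * a%:R \is a Num.int).
  apply: (rat_subgroup_cyclic (fun z => exists x y, L (x, y, z)) D) => //.
  - move=> z z' [x [y h]] [x' [y' h']]; exists (x - x'), (y - y'); exact: LB h h'.
  - by exists 0, 0; have := LZ 0 0 1.
  - by move=> z [x [y /LD []]].
exists q, a, x0, y0, y1; split=> //.
have Mq' x y : L (x, y, 0) -> y * q%:R \is a Num.int by move=> h; apply: Mq; exists x.
have Ma' c : L c -> c.2 * a%:R \is a Num.int.
  by case: c => -[x y] z h; apply: Ma; exists x, y.
split=> //.
have qr : q%:R != 0 :> rat by rewrite pnatr_eq0 -lt0n.
have ar : a%:R != 0 :> rat by rewrite pnatr_eq0 -lt0n.
pose comb (i j : nat) : rat * rat * rat :=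
  (x0 *+ i + y0 *+ j, i%:R / q%:R + y1 *+ j, j%:R / a%:R).
have combE i j : comb i j = (x0, q%:R^-1, 0) *+ i + (y0, y1, a%:R^-1) *+ j.
  have E (u v w : rat) n : (u, v, w) *+ n = (u *+ n, v *+ n, w *+ n).
    by elim: n => [|n IH]; rewrite ?mulr0n // !mulrS IH.
  rewrite !E /comb -[in RHS](mulr_natl q%:R^-1) -(mulr_natl a%:R^-1) mul0rn.
  by congr (_, _, _); rewrite add0r.
have Lfrac c : L (frac3 c) <-> L c.
  have E : frac3 c = c - ((Num.floor c.1.1)%:~R, (Num.floor c.1.2)%:~R, (Num.floor c.2)%:~R).
    by case: c => -[].
  split=> h; last by rewrite E; apply: LB.
  rewrite -[c](subrK ((Num.floor c.1.1)%:~R, (Num.floor c.1.2)%:~R, (Num.floor c.2)%:~R)).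
  by rewrite -E; apply: LA.
have fracr_eq x y : fracr x = fracr y -> x - y \is a Num.int.
  rewrite /fracr => e.
  have -> : x - y = (Num.floor x - Num.floor y)%:~R.
    rewrite rmorphB /=; move: e; move: (_%:~R) (_%:~R) => u v.
    by move/eqP; rewrite subr_eq => /eqP ->; ring.
  exact: intr_int.
exists [seq frac3 (comb i j) | i <- iota 0 q, j <- iota 0 a]; split.
- apply: allpairs_uniq; rewrite ?iota_uniq //.
  move=> [i j] [i' j'] /allpairsP[[u v] /= [hu hv [-> ->]]].
  move=> /allpairsP[[u' v'] /= [hu' hv' [-> ->]]] [_ e2 e3].
  move: hu hv hu' hv'; rewrite !mem_iota /= !add0n => hu hv hu' hv'.
  have vv : v = v' by apply: (divn_int_inj a); rewrite // fracr_eq.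
  rewrite -{}vv in e2 *; congr pair.
  apply: (divn_int_inj q) => //.
  by have /= := fracr_eq _ _ e2; rewrite opprD addrACA subrr addr0.
- by rewrite size_allpairs !size_iota.
- move=> c; split.
    case/allpairsP => -[i j] /= [_ _ ->]; split.
      by rewrite /in_unit_cube /= !fracr_itv.
    by apply/Lfrac; rewrite combE; apply: LA; apply: LMn.
  case=> cube Lc.
  have [z hz] := intrP (Ma' _ Lc).
  pose j := `|(z %% a%:Z)%Z|%N.
  have jE : j%:Z = (z %% a%:Z)%Z by rewrite gez0_abs // modz_ge0 //; lia.
  have ja : (j < a)%N by rewrite -ltz_nat jE ltz_pmod //; lia.
  have c2E : c.2 = (z %/ a%:Z)%Z%:~R + j%:R / a%:R.
    apply: (mulIf ar); rewrite hz mulrDl divfK //.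
    by rewrite [in LHS](divz_eq z a%:Z) rmorphD rmorphM /= -jE -!pmulrn.
  (* Coordinates are cleared from the last to the first by basis vectors and integer vectors, until
     an element (x, 0, 0) of L, hence an integer, remains. *)
  pose d := c - (y0, y1, a%:R^-1) *+ j - (0, 0, (z %/ a%:Z)%Z%:~R).
  have Ld : L d.
    by apply: (LB); [apply: (LB) => //; apply: (LMn)|have := LZ 0 0 (z %/ a%:Z)%Z].
  have Mj : (y0, y1, a%:R^-1) *+ j = (y0 *+ j, y1 *+ j, j%:R / a%:R) :> rat * rat * rat.
    have E (u v w : rat) n : (u, v, w) *+ n = (u *+ n, v *+ n, w *+ n).
      by elim: n => [|n IH]; rewrite ?mulr0n // !mulrS IH.
    by rewrite E -(mulr_natl a%:R^-1).
  have dE : d = (c.1.1 - y0 *+ j, c.1.2 - y1 *+ j, 0).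
    rewrite /d Mj; case: (c) c2E => -[u v] w /= ->.
    by congr (_, _, _); rewrite /=; ring.
  rewrite dE in Ld.
  have [y hy] := intrP (Mq' _ _ Ld).
  pose i := `|(y %% q%:Z)%Z|%N.
  have iE : i%:Z = (y %% q%:Z)%Z by rewrite gez0_abs // modz_ge0 //; lia.
  have iq : (i < q)%N by rewrite -ltz_nat iE ltz_pmod //; lia.
  have d1E : c.1.2 - y1 *+ j = (y %/ q%:Z)%Z%:~R + i%:R / q%:R.
    apply: (mulIf qr); rewrite hy mulrDl divfK //.
    by rewrite [in LHS](divz_eq y q%:Z) rmorphD rmorphM /= -iE -!pmulrn.
  have Mi : (x0, q%:R^-1, 0) *+ i = (x0 *+ i, i%:R / q%:R, 0) :> rat * rat * rat.
    have E (u v w : rat) n : (u, v, w) *+ n = (u *+ n, v *+ n, w *+ n).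
      by elim: n => [|n IH]; rewrite ?mulr0n // !mulrS IH.
    by rewrite E -(mulr_natl q%:R^-1) mul0rn.
  have Le : L (c.1.1 - y0 *+ j - x0 *+ i, 0, 0).
    have := LB _ _ (LB _ _ Ld (LMn _ i Hq)) (LZ 0 (y %/ q%:Z)%Z 0).
    rewrite Mi; congr L; rewrite d1E.
    by congr (_, _, _); rewrite /=; ring.
  have [x hx] := intrP (L0 _ Le).
  apply/allpairsP; exists (i, j); rewrite /= !mem_iota /= !add0n; split=> //.
  have -> : c = frac3 c.
    case/and3P: cube => h1 h2 h3; rewrite /frac3 !fracr_id //.
    by case: (c) => -[].
  rewrite /frac3; congr (_, _, _) => /=.
  - by rewrite -(fracrDint (x0 *+ i + _) x) -hx; congr fracr; ring.
  - rewrite -(fracrDint (i%:R / _ + _) (y %/ q%:Z)%Z); congr fracr.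
    by move/eqP: d1E; rewrite subr_eq => /eqP ->; ring.
  - by rewrite c2E addrC fracrDint.
Qed.

(** * Integral elements and the index *)

Lemma horner_cubpoly (F : comNzRingType) (f : cub) (z : F) :
  (cubpoly F f).[z] =
  z ^+ 3 + (cub_t f)%:~R * z ^+ 2 + (cub_A f)%:~R * z + (cub_B f)%:~R.
Proof. by rewrite /cubpoly !hornerE. Qed.

Lemma cubpoly_monic_size (F : nzRingType) (f : cub) :
  cubpoly F f \is monic /\ size (cubpoly F f) = 4%N.
Proof.
have s : (size ((cub_t f)%:~R *: 'X^2 + (cub_A f)%:~R *: 'X + ((cub_B f)%:~R)%:P : {poly F})%R
          < size ('X^3 : {poly F})%R)%N.
  rewrite size_polyXn ltnS; apply: leq_trans (size_polyD _ _) _.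
  rewrite geq_max; apply/andP; split; last by apply: leq_trans (size_polyC_leq1 _) _.
  apply: leq_trans (size_polyD _ _) _; rewrite geq_max; apply/andP; split.
    by apply: leq_trans (size_scale_leq _ _) _; rewrite size_polyXn.
  by apply: leq_trans (size_scale_leq _ _) _; rewrite size_polyX.
rewrite /cubpoly -!addrA !addrA -addrA -addrA [X in 'X^3 + X]addrA; split.
  by rewrite monicE lead_coefDl // lead_coefXn.
by rewrite size_polyDl // size_polyXn.
Qed.

Lemma cubpoly_roots (F : closedFieldType) (f : cub) :
  exists z1 z2 z3 : F,
    [/\ (cub_t f)%:~R = - (z1 + z2 + z3),
        (cub_A f)%:~R = z1 * z2 + z1 * z3 + z2 * z3,
        (cub_B f)%:~R = - (z1 * z2 * z3) &
        cubpoly F f = ('X - z1%:P) * ('X - z2%:P) * ('X - z3%:P)].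
Proof.
have [mo si] := cubpoly_monic_size F f.
have [r] := closed_field_poly_normal (cubpoly F f).
rewrite (monicP mo) scale1r => E.
have : size r = 3%N by move: si; rewrite E size_prod_XsubC => -[].
case: r E => [|z1 [|z2 [|z3 [|? ?]]]] // E _.
rewrite !big_cons big_nil mulr1 mulrA in E.
exists z1, z2, z3.
have E' : cubpoly F f = 'X^3 - (z1 + z2 + z3) *: 'X^2
   + (z1 * z2 + z1 * z3 + z2 * z3) *: 'X - (z1 * z2 * z3)%:P.
  by rewrite E -!mul_polyC !polyCD !polyCM; ring.
split=> //.
- have := congr1 (fun p : {poly F} => p`_2) E'.
  by rewrite /cubpoly !coefE /= !(mulr0, mulr1, addr0, add0r, oppr0, subr0).
- have := congr1 (fun p : {poly F} => p`_1) E'.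
  by rewrite /cubpoly !coefE /= !(mulr0, mulr1, addr0, add0r, oppr0, subr0).
- have := congr1 (fun p : {poly F} => p`_0) E'.
  by rewrite /cubpoly !coefE /= !(mulr0, mulr1, addr0, add0r, oppr0, subr0).
Qed.

Lemma root_prod3 (F : fieldType) (z1 z2 z3 z : F) :
  root (('X - z1%:P) * ('X - z2%:P) * ('X - z3%:P)) z = (z \in [:: z1; z2; z3]).
Proof. by rewrite !rootM !root_XsubC !inE orbA. Qed.

Lemma disc_roots (F : comNzRingType) (f : cub) (z1 z2 z3 : F) :
  (cub_t f)%:~R = - (z1 + z2 + z3) ->
  (cub_A f)%:~R = z1 * z2 + z1 * z3 + z2 * z3 ->
  (cub_B f)%:~R = - (z1 * z2 * z3) ->
  (disc f)%:~R = ((z1 - z2) * (z1 - z3) * (z2 - z3)) ^+ 2.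
Proof.
move=> h1 h2 h3; rewrite /disc !(rmorphD, rmorphB, rmorphM, rmorphXn, rmorphN) /=.
by rewrite h1 h2 h3; ring.
Qed.

Lemma map_cubpoly (R F : nzRingType) (f : cub) (h : {rmorphism R -> F}) :
  map_poly h (cubpoly R f) = cubpoly F f.
Proof.
rewrite /cubpoly !rmorphD /= !map_polyZ /= map_polyC /= map_polyX !map_polyXn.
by rewrite !rmorph_int.
Qed.

(** * Integrality tested at the roots of f *)

Definition elt_val (c : rat * rat * rat) (z : algC) : algC :=
  ratr c.1.1 + ratr c.1.2 * z + ratr c.2 * z ^+ 2.

(** For disc f != 0, evaluation at the three roots embeds Q[x]/(f) into algC^3, also when f is
    reducible. Testing integrality root by root makes the ring structure of [Aint] available. *)
Definition inO (f : cub) (c : rat * rat * rat) : Prop :=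
  forall z, root (cubpoly algC f) z -> elt_val c z \in Aint.

Lemma Aint_ratr q : ratr q \in Aint -> q \is a Num.int.
Proof.
move=> h; have /intrP[z hz] : (ratr q : algC) \is a Num.int.
  by apply: Cint_rat_Aint => //; apply: Crat_rat.
have : ratr q = ratr z%:~R :> algC by rewrite hz ratr_int.
by move/fmorph_inj ->; exact: intr_int.
Qed.

Lemma Aint_cubic (a b c : int) (z : algC) :
  z ^+ 3 + a%:~R * z ^+ 2 + b%:~R * z + c%:~R = 0 -> z \in Aint.
Proof.
move=> h; apply: (root_monic_Aint (p := cubpoly algC (a, b, c))).
- by rewrite rootE horner_cubpoly h.
- by have [] := cubpoly_monic_size algC (a, b, c).
- rewrite -(map_cubpoly _ _ _ (intr : {rmorphism int -> algC})).
  by apply/polyOverP => i; rewrite coef_map /= intr_int.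
Qed.

Lemma Aint_root (f : cub) z : root (cubpoly algC f) z -> z \in Aint.
Proof. by rewrite rootE horner_cubpoly => /eqP; apply: Aint_cubic. Qed.

(** For the converse, multiply the minimal polynomials of the three values: composed with [elt c],
    the product vanishes at every root of f, and f divides it because disc f != 0 makes the roots
    distinct. *)
Lemma integral_eltP f c : disc f != 0 -> integral_elt f c <-> inO f c.
Proof.
move=> d0.
have comp g z : (map_poly ratr (map_poly (fun z : int => z%:~R) g \Po elt c)).[z] =
    (map_poly intr g : {poly algC}).[elt_val c z].
  rewrite map_comp_poly horner_comp -map_poly_comp.
  congr (_.[_]).
    by apply: eq_map_poly => x /=; rewrite ratr_int.
  rewrite /elt !rmorphD /= !map_polyC /= !map_polyZ /= map_polyX map_polyXn.
  by rewrite !hornerE /= /elt_val expr2 mulrA.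
split.
  case=> g [mg]; rewrite -(dvdp_map (ratr : {rmorphism rat -> algC})) map_cubpoly => dv z rz.
  have /dvdpP[w hw] := dv.
  have := congr1 (fun p : {poly algC} => p.[z]) hw.
  rewrite /= comp hornerM (rootP rz) mulr0 => /rootP rg.
  apply: (root_monic_Aint (p := map_poly intr g)) => //; first exact: monic_map.
  by apply/polyOverP => i; rewrite coef_map /= intr_int.
move=> hO; have [z1 [z2 [z3 [h1 h2 h3 E]]]] := cubpoly_roots algC f.
have Ag x : x \in Aint -> exists g : {poly int}, g \is monic /\ root (map_poly intr g : {poly algC}) x.
  rewrite unfold_in => /floorpP[g hg]; exists g.
  have := root_minCpoly x; have := minCpoly_monic x; rewrite hg => m r.
  split=> //; rewrite monicE; move/monicP: m.
  rewrite /lead_coef size_map_inj_poly //; last exact: intr_inj.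
  by rewrite coef_map /= => e; apply/eqP; apply: (@intr_inj algC).
have r1 : root (cubpoly algC f) z1 by rewrite E root_prod3 inE eqxx.
have r2 : root (cubpoly algC f) z2 by rewrite E root_prod3 !inE eqxx orbT.
have r3 : root (cubpoly algC f) z3 by rewrite E root_prod3 !inE eqxx !orbT.
have [g1 [m1 rg1]] := Ag _ (hO _ r1).
have [g2 [m2 rg2]] := Ag _ (hO _ r2).
have [g3 [m3 rg3]] := Ag _ (hO _ r3).
exists (g1 * g2 * g3); split; first by rewrite !rpredM.
rewrite -(dvdp_map (ratr : {rmorphism rat -> algC})) map_cubpoly E.
have -> : ('X - z1%:P) * ('X - z2%:P) * ('X - z3%:P) =
    \prod_(z <- [:: z1; z2; z3]) ('X - z%:P) :> {poly algC}.
  by rewrite !big_cons big_nil mulr1 mulrA.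
apply: uniq_roots_dvdp.
  by rewrite /= !rootE !comp !rmorphM !hornerM /= (rootP rg1) (rootP rg2) (rootP rg3) !(mulr0, mul0r) eqxx.
rewrite uniq_rootsE /= !inE negb_or.
have : (disc f)%:~R != 0 :> algC by rewrite intr_eq0.
rewrite (disc_roots _ _ _ _ _ h1 h2 h3) expf_eq0 /= !mulf_eq0 !subr_eq0 !negb_or.
by case/andP => /andP[-> ->] ->.
Qed.

Lemma AintN x : x \in Aint -> - x \in Aint.
Proof. by move=> hx; rewrite rpredN. Qed.

Lemma AintD x y : x \in Aint -> y \in Aint -> x + y \in Aint.
Proof. exact: rpredD. Qed.

Lemma AintM x y : x \in Aint -> y \in Aint -> x * y \in Aint.
Proof. exact: rpredM. Qed.

Lemma AintX x n : x \in Aint -> x ^+ n \in Aint.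
Proof. exact: rpredX. Qed.

Ltac aint :=
  repeat first [ assumption
    | match goal with H : forall x, _ -> is_true (_ \in Aint) |- _ => apply: (H); assumption end
    | by apply: Aint_int | by apply: rpred_nat
    | apply: AintN | apply: AintD | apply: AintM | apply: AintX ].

(* [al] is chosen so that [psi * (x - al)] is an integer, where [psi] is the given
   element with leading coefficient [1/m]; integrality of [psi ^+ 2] then yields
   both divisibilities. *)
Lemma cubic_ring_core (Z : algC -> Prop) (m : nat) (a b c : int) (u v : rat) :
  let E (u v w : rat) := forall x, Z x ->
    ratr u + ratr v * x + ratr w * x ^+ 2 \in Aint in
  (0 < m)%N ->
  (forall x, Z x -> x ^+ 3 + a%:~R * x ^+ 2 + b%:~R * x + c%:~R = 0) ->
  (forall u v w, E u v w -> w * m%:R \is a Num.int) ->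
  (forall u v, E u v 0 -> v \is a Num.int) ->
  (forall u, E u 0 0 -> u \is a Num.int) ->
  E u v m%:R^-1 ->
  exists al : int, (m%:Z %| cubd a b al)%Z /\ (m%:Z ^+ 2 %| cubv a b c al)%Z.
Proof.
move=> E m0 rt H2 H1 H0 Epsi.
have mr : m%:R != 0 :> rat by rewrite pnatr_eq0 -lt0n.
have mC : m%:R != 0 :> algC by rewrite pnatr_eq0 -lt0n.
have mz : m%:Z != 0 by rewrite eqz_nat -lt0n.
have AX x : Z x -> x \in Aint by move=> /rt; apply: Aint_cubic.
have AN : m%:R \in Aint by apply: rpred_nat.
have AI (k : int) : k%:~R \in Aint by apply: Aint_int.
have [be hbe] : exists be : int, v = be%:~R / m%:R.
  have /H1/intrP[be hbe] : E (u * m%:R) (v * m%:R) 0.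
    move=> x Zx; have h := Epsi _ Zx.
    have -> : ratr (u * m%:R) + ratr (v * m%:R) * x + ratr 0 * x ^+ 2 =
      (ratr u + ratr v * x + ratr m%:R^-1 * x ^+ 2) * m%:R - x ^+ 2 :> algC.
      rewrite !rmorphM /= !ratr_nat fmorphV /= ratr_nat rmorph0.
      by field.
    by aint.
  by exists be; rewrite -hbe mulfK.
have [ga hga] : exists ga : int, u = ga%:~R / m%:R.
  have /H0/intrP[ga hga] : E (u * m%:R) 0 0.
    move=> x Zx; have h := Epsi _ Zx.
    have -> : ratr (u * m%:R) + ratr 0 * x + ratr 0 * x ^+ 2 =
      (ratr u + ratr v * x + ratr m%:R^-1 * x ^+ 2) * m%:R - x ^+ 2 - be%:~R * x :> algC.
      rewrite hbe !rmorphM /= !fmorphV /= !ratr_nat !ratr_int !rmorph0.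
      by field.
    by aint.
  by exists ga; rewrite -hga mulfK.
have dvdP (k : int) : (k%:~R / m%:R : rat) \is a Num.int -> (m%:Z %| k)%Z.
  move=> /intrP[j hj]; apply/dvdzP; exists j; apply: (@intr_inj rat).
  by rewrite rmorphM /= -hj -pmulrn divfK.
pose psi (x : algC) := (ga%:~R + be%:~R * x + x ^+ 2) / m%:R.
have Apsi x : Z x -> psi x \in Aint.
  move=> Zx; have := Epsi _ Zx; rewrite hga hbe !rmorphM /= !fmorphV /= !ratr_nat !ratr_int.
  have -> // : psi x = ga%:~R / m%:R + be%:~R / m%:R * x + m%:R^-1 * x ^+ 2.
  by rewrite /psi; field.
(* Reducing x^3 by the cubic, this choice cancels the x^2 term of psi * (x - al), leaving a linear
   expression e x + e2; passing from psi to psi - e will remove e x as well. *)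
pose al := be - a.
have /dvdzP[e he] : (m%:Z %| ga - b - al * be)%Z.
  apply: dvdP; refine (H1 ((- c - al * ga)%:~R / m%:R) _ _) => x Zx.
  have -> : ratr ((- c - al * ga)%:~R / m%:R) + ratr ((ga - b - al * be)%:~R / m%:R) * x
     + ratr 0 * x ^+ 2 = x * psi x - al%:~R * psi x :> algC.
    rewrite !rmorphM /= !fmorphV /= !ratr_nat !ratr_int rmorph0 /psi /al.
    rewrite !(rmorphB, rmorphN, rmorphM) /=.
    have ->: c%:~R = - (x ^+ 3 + a%:~R * x ^+ 2 + b%:~R * x) :> algC.
      by apply/eqP; rewrite -addr_eq0 addrC rt.
    by field.
  by aint.
have /dvdzP[e2 he2] : (m%:Z %| - c - al * ga)%Z.
  apply: dvdP; refine (H0 ((- c - al * ga)%:~R / m%:R) _) => x Zx.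
  have -> : ratr ((- c - al * ga)%:~R / m%:R) + ratr 0 * x
     + ratr 0 * x ^+ 2 = x * psi x - al%:~R * psi x - e%:~R * x :> algC.
    have -> : e%:~R = (ga - b - al * be)%:~R / m%:R :> algC by rewrite he rmorphM /= -pmulrn mulfK.
    rewrite !rmorphM /= !fmorphV /= !ratr_nat !ratr_int rmorph0 /psi /al.
    rewrite !(rmorphB, rmorphN, rmorphM) /=.
    have ->: c%:~R = - (x ^+ 3 + a%:~R * x ^+ 2 + b%:~R * x) :> algC.
      by apply/eqP; rewrite -addr_eq0 addrC rt.
    by field.
  by aint.
have [g0 g0E] : exists g0 : int, g0 = al ^+ 2 + a * al + b by exists (al ^+ 2 + a * al + b).
have gaE : ga = g0 + m%:Z * e.
  by rewrite mulrC -he g0E /al; ring.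
have [G GE] : exists G : int, G = - e2 - al * e by exists (- e2 - al * e).
have gE : cubv a b c al = m%:Z * G.
  have -> : cubv a b c al = - (- c - al * ga) - al * (m%:Z * e).
    by rewrite gaE /cubv g0E; ring.
  by rewrite he2 GE; ring.
(* For the cubic f with coefficients a, b, c, this is the quotient of f(x) - f(al) by m (x - al); at
   a root, psi' * (x - al) = - f(al) / m = - G. *)
pose psi' (x : algC) := (g0%:~R + be%:~R * x + x ^+ 2) / m%:R.
have Apsi' x : Z x -> psi' x \in Aint.
  move=> Zx; have -> : psi' x = psi x - e%:~R.
    by rewrite /psi /psi' gaE intrD intrM /= -pmulrn; field.
  by aint.
have [g' g'E] : exists g', g' = cubd a b al by exists (cubd a b al).
(* Expand m psi' in powers of x - al, with constant term f'(al) = g', and multiply by psi'. The x^2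
   coefficient g' / m^2 of psi'^2 gives m | g'; once a multiple of psi' has removed that term, the x
   coefficient - G / m gives m | G. *)
have sq x : Z x -> psi' x ^+ 2 =
    ((- G%:~R) * (x - al%:~R) + (- G%:~R) * (3 * al + a)%:~R + g'%:~R * psi' x) / m%:R.
  move=> Zx; have h1 : psi' x * (x - al%:~R) = - G%:~R.
    apply: (mulIf mC).
    have -> : - G%:~R * m%:R = - (cubv a b c al)%:~R :> algC.
      by rewrite gE rmorphM /= -pmulrn; ring.
    have -> : psi' x * (x - al%:~R) * m%:R = (g0%:~R + be%:~R * x + x ^+ 2) * (x - al%:~R).
      by rewrite /psi'; field.
    have := rt _ Zx; move/eqP; rewrite addr_eq0 => /eqP h.
    have -> : c = cubv a b c al - al ^+ 3 - a * al ^+ 2 - b * al by rewrite /cubv; ring.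
    have -> : (cubv a b (cubv a b c al - al ^+ 3 - a * al ^+ 2 - b * al) al) = cubv a b c al.
      by rewrite /cubv; ring.
    have -> : - (cubv a b c al)%:~R = - c%:~R - al%:~R ^+ 3 - a%:~R * al%:~R ^+ 2 - b%:~R * al%:~R :> algC.
      by rewrite /cubv !(rmorphD, rmorphM, rmorphXn) /=; ring.
    by rewrite -h g0E /al !(rmorphB, rmorphD, rmorphM, rmorphXn) /=; ring.
  rewrite -h1.
  have -> : psi' x ^+ 2 = psi' x * ((g0%:~R + be%:~R * x + x ^+ 2) / m%:R) by [].
  have -> : g0%:~R + be%:~R * x + x ^+ 2 =
     (x - al%:~R) ^+ 2 + (3 * al + a)%:~R * (x - al%:~R) + g'%:~R :> algC.
    by rewrite g'E g0E /al /cubd !(rmorphB, rmorphD, rmorphM, rmorphXn) /=; ring.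
  by move: (psi' x) => y; field.
have /dvdzP[h hh] : (m%:Z %| g')%Z.
  apply: dvdP.
  have := H2 ((G * al - G * (3 * al + a))%:~R / m%:R + g'%:~R * g0%:~R / m%:R ^+ 2)
     (- G%:~R / m%:R + g'%:~R * be%:~R / m%:R ^+ 2) (g'%:~R / m%:R ^+ 2).
  have -> : g'%:~R / m%:R ^+ 2 * m%:R = g'%:~R / m%:R :> rat by field.
  apply=> x Zx.
  have -> : ratr ((G * al - G * (3 * al + a))%:~R / m%:R + g'%:~R * g0%:~R / m%:R ^+ 2) +
    ratr (- G%:~R / m%:R + g'%:~R * be%:~R / m%:R ^+ 2) * x + ratr (g'%:~R / m%:R ^+ 2) * x ^+ 2
    = psi' x ^+ 2 :> algC.
    rewrite sq // /psi' !(rmorphD, rmorphB, rmorphM, rmorphN, fmorphV, rmorphXn) /=.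
    rewrite ?fmorphV /= ?rmorphXn /= !ratr_nat !ratr_int.
    by field.
  by aint.
have /dvdzP[k hk] : (m%:Z %| G)%Z.
  suff : (m%:Z %| - G)%Z by rewrite !dvdzE abszN.
  apply: dvdP.
  refine (H1 ((G * al - G * (3 * al + a))%:~R / m%:R) _ _) => x Zx.
  have -> : ratr ((G * al - G * (3 * al + a))%:~R / m%:R) +
    ratr ((- G)%:~R / m%:R) * x + ratr 0 * x ^+ 2
    = psi' x ^+ 2 - h%:~R * psi' x :> algC.
    rewrite sq // rmorph0 !(rmorphD, rmorphB, rmorphM, rmorphN, fmorphV, rmorphXn) /=.
    rewrite ?fmorphV /= !ratr_nat !ratr_int hh !rmorphM /= -pmulrn.
    by field.
  by aint.
exists al; split; first by rewrite -g'E hh dvdz_mull.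
by rewrite gE hk; apply/dvdzP; exists k; ring.
Qed.

(** Cramer's rule for the Vandermonde system at the roots: V times a coordinate is an algebraic
    integer, hence so is V^2 = disc f times it, and this is rational. It bounds the denominators in
    the lattice. *)
Lemma inO_int_mul (f : cub) (c : rat * rat * rat) : inO f c ->
  c.1.2 * (disc f)%:~R \is a Num.int /\ c.2 * (disc f)%:~R \is a Num.int.
Proof.
move=> hO; have [z1 [z2 [z3 [h1 h2 h3 E]]]] := cubpoly_roots algC f.
have r1 : root (cubpoly algC f) z1 by rewrite E root_prod3 inE eqxx.
have r2 : root (cubpoly algC f) z2 by rewrite E root_prod3 !inE eqxx orbT.
have r3 : root (cubpoly algC f) z3 by rewrite E root_prod3 !inE eqxx !orbT.
have [[a1 a2] a3] := (Aint_root _ _ r1, Aint_root _ _ r2, Aint_root _ _ r3).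
have [[b1 b2] b3] := (hO _ r1, hO _ r2, hO _ r3).
set V := (z1 - z2) * (z1 - z3) * (z2 - z3).
split; apply: Aint_ratr; rewrite rmorphM /= ratr_int (disc_roots _ _ _ _ _ h1 h2 h3).
  have -> : ratr c.1.2 * V ^+ 2 = - V * (elt_val c z1 * (z2 ^+ 2 - z3 ^+ 2) -
     elt_val c z2 * (z1 ^+ 2 - z3 ^+ 2) + elt_val c z3 * (z1 ^+ 2 - z2 ^+ 2)).
    by rewrite /V /elt_val; ring.
  by rewrite /V; aint.
have -> : ratr c.2 * V ^+ 2 = V * (elt_val c z1 * (z2 - z3) -
     elt_val c z2 * (z1 - z3) + elt_val c z3 * (z1 - z2)).
  by rewrite /V /elt_val; ring.
by rewrite /V; aint.
Qed.

Lemma inO_hermite (f : cub) : disc f != 0 ->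
  exists (q a : nat) (x0 y0 y1 : rat), [/\ (0 < q)%N, (0 < a)%N,
    inO f (x0, q%:R^-1, 0) & inO f (y0, y1, a%:R^-1)] /\
    [/\ forall x y, inO f (x, y, 0) -> y * q%:R \is a Num.int,
        forall c, inO f c -> c.2 * a%:R \is a Num.int &
        forall k, ind_is f k <-> k = (q * a)%N].
Proof.
move=> d0.
have [|c d hc hd z rz|a b c z rz|x h|c h|] := lattice_hermite (inO f) `|disc f|%N.
- by rewrite absz_gt0.
- have -> : elt_val (c - d) z = elt_val c z - elt_val d z.
    rewrite /elt_val -[(c - d).1.1]/(c.1.1 - d.1.1) -[(c - d).1.2]/(c.1.2 - d.1.2).
    by rewrite -[(c - d).2]/(c.2 - d.2) !rmorphB /=; ring.
  by have vc := hc _ rz; have vd := hd _ rz; aint.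
- by have Az := Aint_root _ _ rz; rewrite /elt_val /= !ratr_int; aint.
- have [z1 [z2 [z3 [h1 h2 h3 E]]]] := cubpoly_roots algC f.
  apply: Aint_ratr; have /h : root (cubpoly algC f) z1 by rewrite E root_prod3 inE eqxx.
  by rewrite /elt_val /= rmorph0 !mul0r !addr0.
- have E : `|disc f|%:R = (disc f)%:~R :> rat \/ `|disc f|%:R = - (disc f)%:~R :> rat.
    have [e|e] : `|disc f|%N%:Z = disc f \/ `|disc f|%N%:Z = - disc f by lia.
      by left; rewrite pmulrn e.
    by right; rewrite pmulrn e rmorphN.
  have [h1 h2] := inO_int_mul _ _ h.
  by case: E => ->; [split|split; rewrite mulrN rpredN].
move=> q [a [x0 [y0 [y1 [H1 [H2 H3 [s [us ss hs]]]]]]]].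
exists q, a, x0, y0, y1; split=> //; split=> // k; split; last first.
  move=> ->; exists s; split=> // c; rewrite hs.
  by split=> -[h1 h2]; split=> //; apply/(integral_eltP f c d0).
case=> s' [us' ss' hs']; rewrite -ss -ss'; apply/eqP; rewrite -uniq_size_uniq //.
move=> c; apply/idP/idP.
  by move=> /hs[h1 /(integral_eltP f c d0) h2]; apply/hs'.
by move=> /hs'[h1 /(integral_eltP f c d0) h2]; apply/hs.
Qed.

Lemma ind_exists (f : cub) : disc f != 0 -> exists k, ind_is f k.
Proof.
move=> /inO_hermite[q [a [_ [_ [_ [_ [_ _ h]]]]]]].
by exists (q * a)%N; apply/h.
Qed.

(** * The index in terms of q, m and r *)

Lemma PoszX (a n : nat) : (a ^ n)%N%:Z = a%:Z ^+ n.
Proof. by rewrite -!natz natrX. Qed.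

Lemma divn_int_dvd (a d : nat) : (0 < d)%N ->
  d%:R^-1 * a%:R \is a @Num.int rat -> (d %| a)%N.
Proof.
move=> d0 /intrP[z hz]; have dr : d%:R != 0 :> rat by rewrite pnatr_eq0 -lt0n.
have e : a%:Z = z * d%:Z.
  by apply: (@intr_inj rat); rewrite rmorphM /= -!pmulrn -hz mulrAC mulVf // mul1r.
by have : (d%:Z %| a%:Z)%Z by [rewrite e dvdz_mull]; rewrite dvdzE !absz_nat.
Qed.

(** The elements x and psi are integral with leading coefficients 1/q and 1/(q^2 m). Hence q | Q and
    q^2 m | a for the Hermite basis, whose product Q a is the index. *)
Lemma overring_dvd_ind (t A B : int) (k q m : nat) (r : int) :
  disc (t, A, B) != 0 -> ind_is (t, A, B) k -> (0 < q)%N -> (0 < m)%N ->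
  (q%:Z %| 3 * r + t)%Z -> ((q ^ 2 * m)%N%:Z %| cubd t A r)%Z ->
  ((q ^ 3 * m ^ 2)%N%:Z %| cubv t A B r)%Z ->
  (q ^ 3 * m %| k)%N.
Proof.
move=> d0 hk q0 m0 /dvdzP[s hs] /dvdzP[d hd] /dvdzP[v hv].
have [Q [a [x0 [y0 [y1 [[Q0 a0 HQ Ha] [MQ Ma Mk]]]]]]] := inO_hermite _ d0.
have -> : k = (Q * a)%N by apply/Mk.
have qC : q%:R != 0 :> algC by rewrite pnatr_eq0 -lt0n.
have mC : m%:R != 0 :> algC by rewrite pnatr_eq0 -lt0n.
have qr : q%:R != 0 :> rat by rewrite pnatr_eq0 -lt0n.
have mr : m%:R != 0 :> rat by rewrite pnatr_eq0 -lt0n.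
(* [x = (z - r) / q] satisfies [x^3 + s x^2 + m d x + m^2 v = 0], and
   [psi = (x^2 + s x + m d) / m] satisfies [psi^3 - d psi^2 + s v psi - m v^2 = 0]. *)
pose X (z : algC) := (z - r%:~R) / q%:R.
pose G (x : algC) := x ^+ 3 + s%:~R * x ^+ 2 + (m%:Z * d)%:~R * x + (m%:Z ^+ 2 * v)%:~R.
have eqX z : root (cubpoly algC (t, A, B)) z -> G (X z) = 0.
  move=> rz; have ez := rz; rewrite rootE horner_cubpoly /cub_t /cub_A /cub_B /= in ez.
  apply: (mulfI (expf_neq0 3 qC)); rewrite mulr0 -(eqP ez).
  have Et : t%:~R = s%:~R * q%:R - 3 * r%:~R :> algC.
    have -> : t = s * q%:Z - 3 * r by rewrite -hs; ring.
    by rewrite rmorphB !rmorphM /= -pmulrn.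
  have Ed : A%:~R = d%:~R * q%:R ^+ 2 * m%:R - 3 * r%:~R ^+ 2 - 2 * t%:~R * r%:~R :> algC.
    have -> : A = d * (q ^ 2 * m)%N%:Z - 3 * r ^+ 2 - 2 * t * r by rewrite -hd /cubd; ring.
    by rewrite PoszM PoszX !(rmorphB, rmorphM, rmorphXn) /= -!pmulrn; ring.
  have Ev : B%:~R = v%:~R * q%:R ^+ 3 * m%:R ^+ 2 - r%:~R ^+ 3 - t%:~R * r%:~R ^+ 2 - A%:~R * r%:~R :> algC.
    have -> : B = v * (q ^ 3 * m ^ 2)%N%:Z - r ^+ 3 - t * r ^+ 2 - A * r by rewrite -hv /cubv; ring.
    by rewrite PoszM !PoszX !(rmorphB, rmorphM, rmorphXn) /= -!pmulrn; ring.
  rewrite Ev Ed Et /G /X !(rmorphM, rmorphXn) /= -!pmulrn.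
  by field.
have dQ : (q %| Q)%N.
  apply: divn_int_dvd => //; apply: (MQ (- r%:~R / q%:R)) => z rz.
  have -> : elt_val (- r%:~R / q%:R, q%:R^-1, 0) z = X z.
    by rewrite /elt_val /X /= !(rmorphM, rmorphN, fmorphV, rmorph0) /= !ratr_nat ratr_int; field.
  exact: Aint_cubic (eqX _ rz).
have da : (q ^ 2 * m %| a)%N.
  apply: divn_int_dvd; first by rewrite muln_gt0 expn_gt0 q0.
  apply: (Ma ((r%:~R / q%:R) ^+ 2 / m%:R - s%:~R * r%:~R / (q * m)%:R + d%:~R,
     - 2 * r%:~R / (q ^ 2 * m)%:R + s%:~R / (q * m)%:R, (q ^ 2 * m)%:R^-1)) => z rz.
  pose P := (X z ^+ 2 + s%:~R * X z + (m%:Z * d)%:~R) / m%:R.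
  have -> : elt_val ((r%:~R / q%:R) ^+ 2 / m%:R - s%:~R * r%:~R / (q * m)%:R + d%:~R,
     - 2 * r%:~R / (q ^ 2 * m)%:R + s%:~R / (q * m)%:R, (q ^ 2 * m)%:R^-1) z = P.
    rewrite /elt_val /P /X /= !(natrM, natrX).
    rewrite !(rmorphD, rmorphB, rmorphM, rmorphN, rmorphXn, fmorphV) /= !ratr_nat !ratr_int.
    by rewrite -!pmulrn; field; rewrite mC qC.
  refine (Aint_cubic (- d) (s * v) (- (m%:Z * v ^+ 2)) P _).
  apply: (mulfI (expf_neq0 3 mC)).
  (* With W = m P one has G(X) = X W + m^2 v and X (X + s) = W - m d, so G(X) (W (X + s) - m^2 v) =
     W^3 - m d W^2 + m^2 s v W - m^4 v^2. *)
  transitivity (G (X z) * (P * m%:R * (X z + s%:~R) - (m%:Z ^+ 2 * v)%:~R)); last first.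
    by rewrite eqX // mul0r mulr0.
  rewrite /G /P; move: (X z) => x.
  rewrite !(rmorphN, rmorphM, rmorphXn) /= -!pmulrn.
  by field.
by have := dvdn_mul dQ da; rewrite mulnA -expnS.
Qed.

(** The Hermite basis contains X = (z - rho) / q, and X^2 has leading coefficient 1/q^2, so a = q^2
    m. The symmetric functions of the values of X are rational algebraic integers, so X satisfies an
    integral monic cubic. [cubic_ring_core] applied to that cubic yields [al], and r = rho + q
    al. *)
Lemma ind_overring (t A B : int) (k : nat) :
  disc (t, A, B) != 0 -> ind_is (t, A, B) k ->
  exists (q m : nat) (r : int), [/\ (0 < q)%N, (0 < m)%N & k = (q ^ 3 * m)%N] /\
  [/\ (q%:Z %| 3 * r + t)%Z, ((q ^ 2 * m)%N%:Z %| cubd t A r)%Z &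
  ((q ^ 3 * m ^ 2)%N%:Z %| cubv t A B r)%Z].
Proof.
move=> d0 hk.
have [q [a [x0 [y0 [y1 [[q0 a0 Hq Ha] [Mq Ma Mk]]]]]]] := inO_hermite _ d0.
have qC : q%:R != 0 :> algC by rewrite pnatr_eq0 -lt0n.
have qr : q%:R != 0 :> rat by rewrite pnatr_eq0 -lt0n.
have [z1 [z2 [z3 [h1 h2 h3 Ef]]]] := cubpoly_roots algC (t, A, B).
rewrite /cub_t /cub_A /cub_B /= in h1 h2 h3.
have r1 : root (cubpoly algC (t, A, B)) z1 by rewrite Ef root_prod3 inE eqxx.
have r2 : root (cubpoly algC (t, A, B)) z2 by rewrite Ef root_prod3 !inE eqxx orbT.
have r3 : root (cubpoly algC (t, A, B)) z3 by rewrite Ef root_prod3 !inE eqxx !orbT.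
have [rho hrho] : exists rho : int, x0 = - rho%:~R / q%:R.
  have /intrP[y hy] : x0 * q%:R \is a Num.int.
    apply: Aint_ratr; rewrite rmorphM /= ratr_nat.
    have -> : ratr x0 * q%:R = elt_val (x0, q%:R^-1, 0) z1 * q%:R - z1.
      by rewrite /elt_val /= fmorphV /= ratr_nat rmorph0; field.
    have := Hq _ r1; have := Aint_root _ _ r1 => *; aint.
  by exists (- y); rewrite rmorphN /= opprK -hy mulfK.
pose X (z : algC) := (z - rho%:~R) / q%:R.
have elt_valX z : elt_val (x0, q%:R^-1, 0) z = X z.
  by rewrite hrho /elt_val /X /= !(rmorphM, rmorphN, fmorphV, rmorph0) /= !ratr_nat ratr_int; field.
have AX z : root (cubpoly algC (t, A, B)) z -> X z \in Aint by rewrite -elt_valX; apply: Hq.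
have [m aE] : exists m, a = (q ^ 2 * m)%N.
  suff /dvdnP[m ->] : (q ^ 2 %| a)%N by exists m; rewrite mulnC.
  apply: divn_int_dvd; first by rewrite expn_gt0 q0.
  apply: (Ma (x0 ^+ 2, 2 * x0 / q%:R, (q ^ 2)%:R^-1)) => z rz.
  have -> : elt_val (x0 ^+ 2, 2 * x0 / q%:R, (q ^ 2)%:R^-1) z = X z ^+ 2.
    rewrite -elt_valX /elt_val /= natrX !(rmorphM, rmorphXn, fmorphV, rmorph0) /= !ratr_nat.
    by field.
  have := AX _ rz => *; aint.
have m0 : (0 < m)%N by move: a0; rewrite aE muln_gt0 => /andP[].
have mC : m%:R != 0 :> algC by rewrite pnatr_eq0 -lt0n.
have mr : m%:R != 0 :> rat by rewrite pnatr_eq0 -lt0n.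
have cf (y w : int) (n : nat) : y%:~R / q%:R ^+ n \in Aint -> exists j, y = j * q%:Z ^+ n.
  move=> hA; have /intrP[j hj] : (y%:~R / q%:R ^+ n : rat) \is a Num.int.
    by apply: Aint_ratr; rewrite rmorphM fmorphV rmorphXn /= ratr_nat ratr_int.
  exists j; apply: (@intr_inj rat); rewrite rmorphM rmorphXn /= -pmulrn -hj.
  by rewrite divfK // expf_neq0.
have [[X1 X2] X3] := (AX _ r1, AX _ r2, AX _ r3).
have [sa ha] : exists j, 3 * rho + t = j * q%:Z ^+ 1.
  apply: cf => //.
  have -> : (3 * rho + t)%:~R / q%:R ^+ 1 = - (X z1 + X z2 + X z3) :> algC.
    by rewrite rmorphD rmorphM /= h1 /X; field.
  aint.
have [sb hb] : exists j, cubd t A rho = j * q%:Z ^+ 2.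
  apply: cf => //.
  have -> : (cubd t A rho)%:~R / q%:R ^+ 2 = X z1 * X z2 + X z1 * X z3 + X z2 * X z3 :> algC.
    by rewrite /cubd !(rmorphD, rmorphM, rmorphXn) /= h1 h2 /X; field.
  aint.
have [sc hc] : exists j, cubv t A B rho = j * q%:Z ^+ 3.
  apply: cf => //.
  have -> : (cubv t A B rho)%:~R / q%:R ^+ 3 = - (X z1 * X z2 * X z3) :> algC.
    by rewrite /cubv !(rmorphD, rmorphM, rmorphXn) /= h1 h2 h3 /X; field.
  aint.
pose Z (x : algC) := exists2 z, root (cubpoly algC (t, A, B)) z & x = X z.
(* Change of coordinates from 1, X, X^2 to 1, z, z^2 through X = x0 + z / q; [v0] below is chosen so
   that [cv] returns the last basis vector. *)
pose cv (u v w : rat) := (u + v * x0 + w * x0 ^+ 2, (v + 2 * w * x0) / q%:R, w / q%:R ^+ 2).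
have cvE u v w z : elt_val (cv u v w) z = ratr u + ratr v * X z + ratr w * X z ^+ 2.
  rewrite -elt_valX /elt_val /cv /= !(rmorphD, rmorphM, rmorphXn, fmorphV, rmorph0) /= ?rmorphXn /= !ratr_nat.
  by field.
have cvO u v w : (forall x, Z x -> ratr u + ratr v * x + ratr w * x ^+ 2 \in Aint) ->
    inO (t, A, B) (cv u v w).
  by move=> h z rz; rewrite cvE; apply: h; exists z.
pose v0 := q%:R * y1 - 2 * x0 / m%:R.
have [||u v w|u v|u||al [hal1 hal2]] := cubic_ring_core Z m sa sb sc
   (y0 - v0 * x0 - x0 ^+ 2 / m%:R) v0 => //.
- move=> x [z rz ->]; rewrite rootE horner_cubpoly /cub_t /cub_A /cub_B /= in rz.
  apply: (mulfI (expf_neq0 3 qC)); rewrite mulr0 -(eqP rz).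
  have Et : t%:~R = sa%:~R * q%:R - 3 * rho%:~R :> algC.
    have -> : t = sa * q%:Z - 3 * rho by rewrite -[q%:Z]expr1 -ha; ring.
    by rewrite rmorphB !rmorphM /= -pmulrn.
  have Ed : A%:~R = sb%:~R * q%:R ^+ 2 - 3 * rho%:~R ^+ 2 - 2 * t%:~R * rho%:~R :> algC.
    have -> : A = sb * q%:Z ^+ 2 - 3 * rho ^+ 2 - 2 * t * rho by rewrite -hb /cubd; ring.
    by rewrite !(rmorphB, rmorphM, rmorphXn) /= -!pmulrn; ring.
  have Ev : B%:~R = sc%:~R * q%:R ^+ 3 - rho%:~R ^+ 3 - t%:~R * rho%:~R ^+ 2 - A%:~R * rho%:~R :> algC.
    have -> : B = sc * q%:Z ^+ 3 - rho ^+ 3 - t * rho ^+ 2 - A * rho by rewrite -hc /cubv; ring.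
    by rewrite !(rmorphB, rmorphM, rmorphXn) /= -!pmulrn; ring.
  rewrite Ev Ed Et /X; by field.
- move=> /cvO /Ma /=; rewrite aE natrM natrX.
  by have -> : w / q%:R ^+ 2 * (q%:R ^+ 2 * m%:R) = w * m%:R by field.
- move=> /cvO; rewrite /cv mulr0 !mul0r !addr0 => /Mq.
  by rewrite divfK.
- move=> /cvO hO; apply: Aint_ratr; have := hO _ r1; rewrite cvE.
  by rewrite rmorph0 !mul0r !addr0.
- move=> x [z rz ->]; rewrite -cvE; have h := Ha _ rz.
  have <- : (y0, y1, a%:R^-1) = cv (y0 - v0 * x0 - x0 ^+ 2 / m%:R) v0 m%:R^-1; last exact: h.
  rewrite /cv aE natrM natrX /v0.
  by congr (_, _, _); field; rewrite ?qr ?mr.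
exists q, m, (rho + q%:Z * al); split.
  by split=> //; rewrite expnS -mulnA -aE; apply/Mk.
split.
- have -> : 3 * (rho + q%:Z * al) + t = (3 * rho + t) + 3 * q%:Z * al by ring.
  by rewrite ha; apply/dvdzP; exists (sa + 3 * al); ring.
- have -> : cubd t A (rho + q%:Z * al) = cubd t A rho + 2 * (3 * rho + t) * q%:Z * al
     + 3 * q%:Z ^+ 2 * al ^+ 2 by rewrite /cubd; ring.
  move/dvdzP: hal1 => [e he].
  rewrite ha hb PoszM; apply/dvdzP; exists e.
  have -> : (q ^ 2)%N%:Z = q%:Z ^+ 2 by rewrite PoszX.
  transitivity (q%:Z ^+ 2 * cubd sa sb al); first by rewrite /cubd; ring.
  by rewrite he; ring.
- have -> : cubv t A B (rho + q%:Z * al) = cubv t A B rho + cubd t A rho * (q%:Z * al)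
     + (3 * rho + t) * q%:Z ^+ 2 * al ^+ 2 + q%:Z ^+ 3 * al ^+ 3 by rewrite /cubv /cubd; ring.
  move/dvdzP: hal2 => [e he].
  rewrite ha hb hc PoszM; apply/dvdzP; exists e.
  have -> : (q ^ 3)%N%:Z = q%:Z ^+ 3 by rewrite PoszX.
  have -> : (m ^ 2)%N%:Z = m%:Z ^+ 2 by rewrite PoszX.
  transitivity (q%:Z ^+ 3 * cubv sa sb sc al); first by rewrite /cubv; ring.
  by rewrite he; ring.
Qed.

(** The p-parts of q and m serve at p, with the same r, since n | q^3 m gives v_p(n) <= 3 v_p(q) +
    v_p(m). *)
Lemma Sigma_index_cond n t A B : (0 < n)%N -> Sigma n (t, A, B) -> index_cond n t A B.
Proof.
move=> n0 [_ d0 [k [hk nk]]].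
have [q [m [r [[q0 m0 kE] [h1 h2 h3]]]]] := ind_overring _ _ _ _ d0 hk.
apply/allP => p; rewrite mem_primes => /and3P[pp _ pn].
have lq : (p ^ logn p q %| q)%N by rewrite pfactor_dvdnn.
have lm : (p ^ logn p m %| m)%N by rewrite pfactor_dvdnn.
have pwd i (y : nat) x : (p ^ i %| y)%N -> (y%:Z %| x)%Z -> (ppow p i %| x)%Z.
  by move=> h; apply: dvdz_trans; rewrite dvdzE !absz_nat.
apply: (local_cond_of_overring p _ t A B (logn p q) (logn p m) r).
- have k0 : (0 < k)%N by rewrite kE muln_gt0 expn_gt0 q0 m0.
  have := dvdn_leq_log p k0 nk.
  by rewrite kE lognM ?expn_gt0 ?q0 // lognX.
- exact: pwd h1.
- by apply: pwd h2; rewrite expnD [(2 * _)%N]mulnC expnM; apply: dvdn_mul; [apply: dvdn_exp2r|].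
- apply: pwd h3; rewrite expnD [(3 * _)%N]mulnC [(2 * _)%N]mulnC !expnM.
  by apply: dvdn_mul; apply: dvdn_exp2r.
Qed.

(** Different primes may come with different r, so divisibility of the index is checked one prime
    power at a time. *)
Lemma index_cond_Sigma n t A B : (0 < n)%N -> inV (t, A, B) -> disc (t, A, B) != 0 ->
  index_cond n t A B -> Sigma n (t, A, B).
Proof.
move=> n0 hV d0 /allP hW; split=> //.
have [k hk] := ind_exists _ d0; exists k; split=> //.
apply/dvdn_partP => // p hp.
have pr : p \in primes n by [].
have /asboolP[i [r /and4P[g1 g2 g3 g4]]] := hW p pr.
move: pr; rewrite mem_primes => /and3P[pp _ pn]; have p0 := prime_gt0 pp.
rewrite p_part; set l := (logn p n - 3 * i)%N in g3 g4.
apply: (@dvdn_trans ((p ^ i) ^ 3 * p ^ l)).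
  by rewrite -expnM -expnD; apply: dvdn_exp2l; rewrite /l; clear; lia.
apply: (overring_dvd_ind t A B k (p ^ i) (p ^ l) r) => //; rewrite ?expn_gt0 ?p0 //.
  by rewrite -expnM [(i * 2)%N]mulnC -expnD.
by rewrite -!expnM [(l * 2)%N]mulnC [(i * 3)%N]mulnC -expnD.
Qed.

(** * Coefficient bounds *)

Definition cnorm (R : rcfType) (z : R[i]) : R :=
  Num.sqrt (complex.Re z ^+ 2 + complex.Im z ^+ 2).

Lemma cnormM (R : rcfType) (x y : R[i]) : cnorm R (x * y) = cnorm R x * cnorm R y.
Proof. by have := ComplexField.Normc.normcM x y; case: x => a b; case: y. Qed.

Lemma cnormD (R : rcfType) (x y : R[i]) : cnorm R (x + y) <= cnorm R x + cnorm R y.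
Proof. by have := @le_normcD R x y; case: x => a b; case: y. Qed.

Lemma cnormN (R : rcfType) (x : R[i]) : cnorm R (- x) = cnorm R x.
Proof. by have := @normcN R x; case: x. Qed.

Lemma cnorm_ge0 (R : rcfType) (x : R[i]) : 0 <= cnorm R x.
Proof. exact: sqrtr_ge0. Qed.

Lemma cnorm_int (R : rcfType) (z : int) : cnorm R z%:~R = `|z%:~R|.
Proof.
have -> : (z%:~R : R[i]) = real_complex R z%:~R by rewrite rmorph_int.
by rewrite /cnorm /= expr0n /= addr0 sqrtr_sqr.
Qed.

Lemma coef_bounds (R : realType) (f : cub) (Y : R) : h_lt f Y ->
  `|(cub_A f)%:~R| <= 3 * Y ^+ 2 /\ `|(cub_B f)%:~R| <= Y ^+ 3.
Proof.
move=> h; have [z1 [z2 [z3 [e1 e2 e3 E]]]] := cubpoly_roots R[i] f.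
have r1 : root (cubpoly R[i] f) z1 by rewrite E root_prod3 inE eqxx.
have r2 : root (cubpoly R[i] f) z2 by rewrite E root_prod3 !inE eqxx orbT.
have r3 : root (cubpoly R[i] f) z3 by rewrite E root_prod3 !inE eqxx !orbT.
have /ltW b1 := h _ r1; have /ltW b2 := h _ r2; have /ltW b3 := h _ r3.
rewrite -/(cnorm R z1) in b1; rewrite -/(cnorm R z2) in b2; rewrite -/(cnorm R z3) in b3.
have [[g1 g2] g3] := (cnorm_ge0 R z1, cnorm_ge0 R z2, cnorm_ge0 R z3).
have m x y : cnorm R x <= Y -> cnorm R y <= Y -> cnorm R (x * y) <= Y ^+ 2.
  by move=> hx hy; rewrite cnormM expr2 ler_pM ?cnorm_ge0.
rewrite -!cnorm_int e2 e3; split.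
  apply: le_trans (cnormD _ _ _) _; have := cnormD _ (z1 * z2) (z1 * z3).
  have := m _ _ b1 b2; have := m _ _ b1 b3; have := m _ _ b2 b3; lra.
by rewrite cnormN cnormM exprSr ler_pM ?cnorm_ge0 ?m.
Qed.

(** If Y < 1, the integer B has absolute value below 1, so B = 0 and some root is 0; then A is the
    product of the other two roots, so A = 0, and x^3 + t x^2 has discriminant 0. The bound Y >= 1
    later absorbs a rounding term 1 into Y^2. *)
Lemma height_ge1 (R : realType) (f : cub) (Y : R) : 0 < Y -> h_lt f Y -> disc f != 0 -> 1 <= Y.
Proof.
move=> Y0 h d0; rewrite leNgt; apply/negP => Y1.
have [z1 [z2 [z3 [e1 e2 e3 E]]]] := cubpoly_roots R[i] f.
have r1 : root (cubpoly R[i] f) z1 by rewrite E root_prod3 inE eqxx.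
have r2 : root (cubpoly R[i] f) z2 by rewrite E root_prod3 !inE eqxx orbT.
have r3 : root (cubpoly R[i] f) z3 by rewrite E root_prod3 !inE eqxx !orbT.
have b1 : cnorm R z1 < 1 by apply: lt_trans (h _ r1) Y1.
have b2 : cnorm R z2 < 1 by apply: lt_trans (h _ r2) Y1.
have b3 : cnorm R z3 < 1 by apply: lt_trans (h _ r3) Y1.
have m x y : cnorm R x < 1 -> cnorm R y < 1 -> cnorm R (x * y) < 1.
  move=> hx hy; rewrite cnormM; have := cnorm_ge0 R x; have := cnorm_ge0 R y; nra.
have int0 (z : int) : cnorm R z%:~R < 1 -> z = 0.
  rewrite cnorm_int -intr_norm -[1]/(1%:~R) ltr_int; lia.
have B0 : cub_B f = 0 by apply: int0; rewrite e3 cnormN !m.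
have A0 : cub_A f = 0.
  apply: int0; rewrite e2; move/eqP: e3; rewrite B0 eq_sym oppr_eq0 !mulf_eq0 -orbA.
  by case/or3P => /eqP ->; rewrite ?(mul0r, mulr0, add0r, addr0) m.
by case/eqP: d0; rewrite /disc A0 B0; ring.
Qed.

(** * Density and the final count *)

(** Since the inner count depends only on a mod n, dividing by n^3 gives the proportion of
    admissible (A, B) for this t. *)
Definition index_count (n : nat) (t : int) : nat :=
  \sum_(0 <= a < n) count_res (n ^ 2) (index_cond n t a%:Z).

(** The second difference of disc in B with step L is the constant - 54 L^2. This is needed because
    [Sigma] demands disc != 0, while a cylinder sees residues only. *)
Lemma exists_disc_neq0 (t A B : int) (L : nat) : (0 < L)%N ->
  exists j : int, disc (t, A, B + L%:Z * j) != 0.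
Proof.
move=> L0; case: (pselect (exists j : int, disc (t, A, B + L%:Z * j) != 0)) => // h.
have e (j : int) : disc (t, A, B + L%:Z * j) = 0.
  by apply/eqP; apply: contra_notT h => hj; exists j.
have e0 := e 0; have e1 := e 1; have e2 := e 2.
have : - 54 * L%:Z ^+ 2 = 0.
  rewrite -[RHS](_ : 0 - 2 * 0 + 0 = 0) // -{1}e2 -{1}e1 -e0.
  by rewrite /disc /cub_t /cub_A /cub_B /=; ring.
by move/eqP; rewrite mulf_eq0 expf_eq0 /= eqz_nat; lia.
Qed.

(** Modulo L = m n^2 both the residue mod m and the index condition in B are visible. There are m^2
    n [index_count] admissible pairs, and at most (n^2)^2 of them, told apart by their quotients by
    m, share a residue pair mod m. *)
Lemma nres_ge n m t : (0 < n)%N -> (0 < m)%N -> t \in [:: -1; 0; 1] ->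
  (index_count n t * m ^ 2 <= nres (Sigma n) t m * n ^ 3)%N.
Proof.
move=> n0 m0 ht; pose L := (m * n ^ 2)%N.
have n20 : (0 < n ^ 2)%N by rewrite expn_gt0 n0.
have L0 : (0 < L)%N by rewrite muln_gt0 m0.
pose U := [set p : 'I_L * 'I_L | index_cond n t (p.1 : nat)%:Z (p.2 : nat)%:Z].
have cU : #|U| = (m * (m * n * index_count n t))%N.
  have -> : #|U| = (\sum_(0 <= x < L) count_res L (index_cond n t x%:Z))%N.
    rewrite big_mkord -sum1dep_card -(pair_big_dep xpredT (fun i j : 'I_L => index_cond n t (i : nat)%:Z (j : nat)%:Z) (fun _ _ => 1%N)) /=.
    by apply: eq_bigr => i _; rewrite count_resE sum1dep_card.
  have e (x : nat) : count_res L (index_cond n t x%:Z) = (m * count_res (n ^ 2) (index_cond n t x%:Z))%N.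
    by rewrite /L mulnC count_res_lift //; apply: index_cond_periodic.
  rewrite (eq_bigr _ (fun x _ => e x)) -big_distrr /=; congr (_ * _)%N.
  have -> : L = (n * (m * n))%N by rewrite /L expnS expn1; lia.
  rewrite (sum_periodic _ _ (fun x => count_res (n ^ 2) (index_cond n t x%:Z))) // => x.
  by apply: index_cond_count_eq => //; rewrite PoszD addrC addKr dvdzz.
have md x : (x %% m < m)%N by rewrite ltn_mod.
have dv (x : 'I_L) : (x %/ m < n ^ 2)%N by rewrite ltn_divLR // mulnC.
pose F (p : 'I_L * 'I_L) : ('I_m * 'I_m) * ('I_(n ^ 2) * 'I_(n ^ 2)) :=
  ((Ordinal (md p.1), Ordinal (md p.2)), (Ordinal (dv p.1), Ordinal (dv p.2))).
have Fi : injective F.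
  move=> [a b] [a' b'] [h1 h2 h3 h4]; congr pair; apply/val_inj.
    by rewrite /= (divn_eq a m) h1 h3 -divn_eq.
  by rewrite /= (divn_eq b m) h2 h4 -divn_eq.
have : (#|U| <= nres (Sigma n) t m * (n ^ 2 * n ^ 2))%N.
  rewrite -(card_imset _ Fi) /nres.
  have <- : #|[set: 'I_(n ^ 2) * 'I_(n ^ 2)]| = (n ^ 2 * n ^ 2)%N.
    by rewrite cardsT card_prod !card_ord.
  rewrite -cardsX; apply: subset_leq_card; apply/fintype.subsetP => y /imsetP[[a b]].
  rewrite inE /= => Wab ->; rewrite !inE /= andbT; apply/asboolP.
  have [j dj] := exists_disc_neq0 t (a : nat)%:Z (b : nat)%:Z L L0.
  exists (a : nat)%:Z, ((b : nat)%:Z + L%:Z * j); split; [|split].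
  - apply: index_cond_Sigma => //; rewrite (index_cond_periodic n t _ n0 _ (b : nat)%:Z) //.
    by rewrite addrC addKr; apply: dvdz_mulr; rewrite dvdzE !absz_nat dvdn_mull.
  - by rewrite modz_nat /= modz_nat modn_mod.
  - have -> : L%:Z * j = (n ^ 2)%N%:Z * j * m%:Z by rewrite /L PoszM; ring.
    by rewrite addrC modzMDl /= !modz_nat modn_mod.
rewrite cU => h; rewrite -(leq_pmul2r n0).
have -> : (index_count n t * m ^ 2 * n = m * (m * n * index_count n t))%N by rewrite expnS expn1; lia.
by apply: leq_trans h _; rewrite -mulnA -expnSr -expnD.
Qed.

Lemma nu_ge (R : realType) n : (0 < n)%N ->
  (\sum_(t <- [:: -1; 0; 1]) (index_count n t)%:R) <= 3 * n%:R ^+ 3 * nu R (Sigma n).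
Proof.
move=> n0; have n3 : 0 < 3 * n%:R ^+ 3 :> R by rewrite mulr_gt0 // exprn_gt0 // ltr0n.
rewrite -ler_pdivrMl //; apply: lb_le_inf.
  by exists (3%:R^-1 * (\sum_(t <- [:: (-1)%R; 0%R; 1%R]) (nres (Sigma n) t 1)%:R) / (1%:R ^+ 2)), 1%N.
move=> _ [m [m0 ->]].
have m2 : 0 < m%:R ^+ 2 :> R by rewrite exprn_gt0 // ltr0n.
rewrite ler_pdivlMr // invfM -!mulrA ler_pM2l ?invr_gt0 //.
rewrite ler_pdivrMl ?exprn_gt0 ?ltr0n // mulr_suml mulr_sumr !big_cons !big_nil !addr0.
have k t : t \in [:: -1; 0; 1] ->
    (index_count n t)%:R * m%:R ^+ 2 <= n%:R ^+ 3 * (nres (Sigma n) t m)%:R :> R.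
  by move=> ht; rewrite -!natrX -!natrM ler_nat [leqRHS]mulnC nres_ge.
by rewrite !lerD // k.
Qed.

(** * Counting in residue classes and short intervals *)

Lemma sum_fibers (T K : eqType) (s : seq T) (ks : seq K) (key : T -> K) (F : T -> nat) :
  uniq ks -> (forall x, x \in s -> key x \in ks) ->
  (\sum_(x <- s) F x = \sum_(k <- ks) \sum_(x <- s | key x == k) F x)%N.
Proof.
move=> uk hk; under [RHS]eq_bigr => k _ do rewrite big_mkcond /=.
rewrite exchange_big /= big_seq [RHS]big_seq; apply: eq_bigr => x xs.
rewrite -big_mkcond /= (eq_bigl (pred1 (key x))); last by move=> k /=; rewrite eq_sym.
by rewrite -big_filter filter_pred1_uniq ?hk // big_seq1.
Qed.

(** All elements are x0 + q N with |q| <= k = floor(D / N), which allows 2 k + 1 values. *)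
Lemma size_congr_le (R : realType) (l : seq int) (N : nat) (D : R) : (0 < N)%N -> 0 <= D ->
  uniq l -> (forall x y, x \in l -> y \in l -> (N%:Z %| x - y)%Z /\ `|(x - y)%:~R| <= D) ->
  (size l)%:R <= 2 * D / N%:R + 1.
Proof.
case: l => [|x0 l] N0 D0 ul h.
  by rewrite /= addr_ge0 // divr_ge0 // mulr_ge0.
have NR : 0 < N%:R :> R by rewrite ltr0n.
have DN : 0 <= D / N%:R by rewrite divr_ge0.
pose k := Num.truncn (D / N%:R).
have kle : k%:R <= D / N%:R by rewrite truncn_le.
apply: (@le_trans _ _ (2 * k + 1)%N%:R); last first.
  by rewrite natrD natrM lerD2r -mulrA ler_pM2l.
rewrite ler_nat.
pose g (x : int) : nat := absz (((x - x0) %/ N%:Z)%Z + k%:Z).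
have Q x : x \in x0 :: l -> exists q : int, [/\ x = x0 + q * N%:Z, ((x - x0) %/ N%:Z)%Z = q & - k%:Z <= q <= k%:Z].
  move=> hx; have [/dvdzP[q hq] hD] := h x x0 hx (mem_head _ _).
  exists q; split; first by rewrite -hq; ring.
    by rewrite hq mulzK //; lia.
  have : `|q|%N%:R <= D / N%:R.
    rewrite ler_pdivlMr //; apply: le_trans hD; rewrite hq rmorphM /= normrM.
    by rewrite -pmulrn normr_nat -intr_norm pmulrn abszE.
  rewrite -truncn_ge_nat // -/k; lia.
have gi : {in x0 :: l &, injective g}.
  move=> x y /Q[q [-> e1 b1]] /Q[q' [-> e2 b2]]; rewrite /g e1 e2 => e.
  by congr (_ + _ * _); lia.
rewrite -(size_map g) -[X in (_ <= X)%N](size_iota 0).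
apply: uniq_leq_size; first by rewrite map_inj_in_uniq.
move=> _ /mapP[x /Q[q [_ e b]] ->]; rewrite mem_iota /g e; lia.
Qed.

(** When u x and u y have no opposite signs, (u x - u y)^2 <= |(u x)^2 - (u y)^2|, which is 27 times
    a difference of discriminants and so below 54 X. As u x - u y = 27 (x - y), this gives (x - y)^2
    < 2 X / 27. *)
Lemma disc_gap (R : realType) (t A x y : int) (X Y : R) :
  let u (B : int) := 2 * t ^+ 3 - 9 * t * A + 27 * B in
  0 < X -> 0 < Y -> 0 <= u x * u y ->
  `|x%:~R| <= Y ^+ 3 -> `|y%:~R| <= Y ^+ 3 ->
  `|(disc (t, A, x))%:~R| < X -> `|(disc (t, A, y))%:~R| < X ->
  `|(x - y)%:~R| <= 2 * Num.min (Y ^+ 3) (Num.sqrt X).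
Proof.
move=> u X0 Y0 uxy hx hy dx dy; set d : R := (x - y)%:~R.
have h1 : `|d| <= 2 * Y ^+ 3.
  rewrite /d rmorphB /=; apply: le_trans (ler_normB _ _) _; lra.
suff h2 : `|d| <= Num.sqrt X by rewrite /Num.min; case: ifP => _ //; have := normr_ge0 d; lra.
rewrite -sqrtr_sqr ler_sqrt; last exact: ltW.
have E : 27 * (disc (t, A, y) - disc (t, A, x)) = (u x) ^+ 2 - (u y) ^+ 2.
  by rewrite /u /disc /cub_t /cub_A /cub_B /=; ring.
have E2 : u x - u y = 27 * (x - y) by rewrite /u; ring.
have : (27 * (x - y)) ^+ 2 <= 27 * `|disc (t, A, y) - disc (t, A, x)|.
  rewrite -[27 in leRHS]ger0_norm // -normrM E -E2; move: uxy; clear.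
  move: (u x) (u y) => a b h.
  have [ab|ba] := lerP (a ^+ 2) (b ^+ 2); nia.
rewrite -(ler_int R) exprMn !rmorphM /= -/d intr_norm rmorphB /= => hle.
have := ler_normB (disc (t, A, y))%:~R ((disc (t, A, x))%:~R : R).
rewrite expr2; have := sqr_ge0 d; rewrite expr2; lra.
Qed.

(** The sign of u splits the list in two; with M the minimum, each half has diameter at most 2 M and
    contributes 4 M / n^2 + 1. *)
Lemma class_size (R : realType) (t A : int) (n : nat) (X Y : R) (bs : seq int) :
  (0 < n)%N -> 0 < X -> 0 < Y -> uniq bs ->
  (forall x, x \in bs -> `|x%:~R| <= Y ^+ 3 /\ `|(disc (t, A, x))%:~R| < X) ->
  (forall x y, x \in bs -> y \in bs -> ((n ^ 2)%N%:Z %| x - y)%Z) ->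
  (size bs)%:R <= 8 * Num.min (Y ^+ 3) (Num.sqrt X) / n%:R ^+ 2 + 2.
Proof.
move=> n0 X0 Y0 ub hb hc; set M := Num.min _ _.
have M0 : 0 <= M by rewrite /M le_min sqrtr_ge0 exprn_ge0 // ltW.
have n20 : (0 < n ^ 2)%N by rewrite expn_gt0 n0.
pose u (B : int) := 2 * t ^+ 3 - 9 * t * A + 27 * B.
pose P B := 0 <= u B.
have D0 : 0 <= 2 * M by lra.
have b1 : (size (filter P bs))%:R <= 2 * (2 * M) / (n ^ 2)%N%:R + 1 :> R.
  apply: size_congr_le => //; first exact: filter_uniq.
  move=> x y; rewrite !mem_filter => /andP[px xb] /andP[py yb]; split; first exact: hc.
  have [h1 h2] := hb _ xb; have [h3 h4] := hb _ yb.
  by apply: (disc_gap _ t A) => //; apply: mulr_ge0.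
have b2 : (size (filter (predC P) bs))%:R <= 2 * (2 * M) / (n ^ 2)%N%:R + 1 :> R.
  apply: size_congr_le => //; first exact: filter_uniq.
  move=> x y; rewrite !mem_filter /= /P -!ltNge => /andP[px xb] /andP[py yb]; split; first exact: hc.
  have [h1 h2] := hb _ xb; have [h3 h4] := hb _ yb.
  by apply: (disc_gap _ t A) => //; apply: mulr_le0; apply: ltW.
have -> : size bs = (size (filter P bs) + size (filter (predC P) bs))%N.
  by rewrite !size_filter count_predC.
rewrite natrD; move: b1 b2; rewrite natrX.
have -> : 2 * (2 * M) / n%:R ^+ 2 = 4 * (M / n%:R ^+ 2) by ring.
have -> : 8 * M / n%:R ^+ 2 = 8 * (M / n%:R ^+ 2) by ring.
lra.
Qed.

Lemma fixed_A_size (R : realType) (t A : int) (n : nat) (X Y : R) (bs : seq int) :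
  (0 < n)%N -> 0 < X -> 0 < Y -> uniq bs ->
  (forall x, x \in bs -> [/\ index_cond n t A x, `|x%:~R| <= Y ^+ 3 & `|(disc (t, A, x))%:~R| < X]) ->
  (size bs)%:R <= (count_res (n ^ 2) (index_cond n t A))%:R *
     (8 * Num.min (Y ^+ 3) (Num.sqrt X) / n%:R ^+ 2 + 2).
Proof.
move=> n0 X0 Y0 ub hb; set N := (n ^ 2)%N; set kap := _ + 2.
have N0 : (0 < N)%N by rewrite expn_gt0 n0.
pose key (x : int) : nat := absz (x %% N%:Z)%Z.
have keyE x : (key x)%:Z = (x %% N%:Z)%Z by rewrite /key gez0_abs // modz_ge0 //; lia.
pose ks := filter (fun k : nat => index_cond n t A k%:Z) (iota 0 N).
have sk : size ks = count_res N (index_cond n t A).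
  by rewrite /count_res size_filter -sum1_count big_mkcond /= /index_iota subn0; apply: eq_bigr => i _; case: ifP.
have uk : uniq ks by rewrite filter_uniq // iota_uniq.
have mk x : x \in bs -> key x \in ks.
  move=> /hb[Wx _ _]; rewrite mem_filter mem_iota /=; apply/andP; split.
    by rewrite -(index_cond_periodic n t A n0 x) // keyE -eqz_mod_dvd modz_mod.
  by rewrite add0n -ltz_nat keyE ltz_pmod //; lia.
rewrite -sum1_size (sum_fibers _ _ _ ks key) // natr_sum.
apply: (@le_trans _ _ (\sum_(k <- ks) kap)); last first.
  by rewrite big_const_seq count_predT iter_addr_0 sk mulr_natl.
apply: ler_sum => k _; rewrite -big_filter sum1_size.
apply: (class_size _ t A) => //; first exact: filter_uniq.
  by move=> x; rewrite mem_filter => /andP[_ /hb[]].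
move=> x y; rewrite !mem_filter => /andP[/eqP kx _] /andP[/eqP ky _].
by rewrite -eqz_mod_dvd -!keyE kx ky.
Qed.

(** The first bound groups the A by residue mod n and feeds the main term. The second feeds the
    rounding term: at most 12 Y^2 + 1 <= 13 Y^2 values of A, each with at most 27 n classes, and 351
    = 13 * 27. *)
Lemma sum_count_index_cond (R : realType) (t : int) (n : nat) (Y : R) (As : seq int) :
  (0 < n)%N -> 1 <= Y -> uniq As -> (forall A, A \in As -> `|A%:~R| <= 3 * Y ^+ 2) ->
  (\sum_(A <- As) count_res (n ^ 2) (index_cond n t A))%N%:R <= (12 * Y ^+ 2 / n%:R + 1) * (index_count n t)%:R :> R
  /\ (\sum_(A <- As) count_res (n ^ 2) (index_cond n t A))%N%:R <= 351 * (n%:R * Y ^+ 2) :> R.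
Proof.
move=> n0 Y1 uA hA.
have Y21 : 1 <= Y ^+ 2 by rewrite exprn_ege1.
have dA x y : x \in As -> y \in As -> `|(x - y)%:~R| <= 6 * Y ^+ 2 :> R.
  move=> /hA hx /hA hy; rewrite rmorphB /=; apply: le_trans (ler_normB _ _) _; lra.
have nR : 0 < n%:R :> R by rewrite ltr0n.
split; last first.
  apply: (@le_trans _ _ (\sum_(A <- As) (27 * n)%N%:R)).
    by rewrite natr_sum; apply: ler_sum => A _; rewrite ler_nat count_index_cond_le.
  rewrite big_const_seq count_predT iter_addr_0 -[X in X <= _]mulr_natl natrM.
  have : (size As)%:R <= 2 * (6 * Y ^+ 2) / 1%:R + 1 :> R.
    apply: size_congr_le => //; first by lra.
    by move=> x y hx hy; split; [rewrite dvd1z|apply: dA].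
  rewrite divr1 => h; have h' : (size As)%:R <= 13 * Y ^+ 2 :> R by lra.
  have -> : 351 * (n%:R * Y ^+ 2) = 13 * Y ^+ 2 * (27 * n%:R) :> R by ring.
  by rewrite ler_pM2r // mulr_gt0.
pose key (x : int) : nat := absz (x %% n%:Z)%Z.
have keyE x : (key x)%:Z = (x %% n%:Z)%Z by rewrite /key gez0_abs // modz_ge0 //; lia.
rewrite (sum_fibers _ _ _ (iota 0 n) key) ?iota_uniq //; last first.
  by move=> x _; rewrite mem_iota add0n -ltz_nat keyE ltz_pmod //; lia.
rewrite natr_sum /index_count natr_sum mulr_sumr /index_iota subn0; apply: ler_sum => k _.
apply: (@le_trans _ _ ((size [seq x <- As | key x == k])%:R * (count_res (n ^ 2) (index_cond n t k%:Z))%:R)).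
  rewrite -natrM ler_nat -big_filter.
  rewrite (@eq_big_seq _ _ _ _ _ _ (fun _ => count_res (n ^ 2) (index_cond n t k%:Z))).
    by rewrite big_const_seq count_predT iter_addn_0 mulnC.
  move=> x; rewrite mem_filter => /andP[/eqP kx _]; apply: index_cond_count_eq => //.
  by rewrite -kx keyE -eqz_mod_dvd modz_mod.
apply: ler_wpM2r => //.
have -> : 12 * Y ^+ 2 / n%:R + 1 = 2 * (6 * Y ^+ 2) / n%:R + 1 by ring.
apply: size_congr_le => //; [lra|exact: filter_uniq|].
move=> x y; rewrite !mem_filter => /andP[/eqP kx hx] /andP[/eqP ky hy].
by split; [rewrite -eqz_mod_dvd -!keyE kx ky|apply: dA].
Qed.

(* "#S <= bound" is expressed as: every duplicate-free finite list of
   elements of S has length <= bound. The implied constant C is absolute. *)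
Theorem theorem3p6 (R : realType) :
  exists C : R, 0 < C /\
  forall (n : nat) (X Y : R), (0 < n)%N -> 0 < X -> 0 < Y ->
  forall s : seq cub, uniq s ->
    (forall f, f \in s -> [/\ Sigma n f, `|(disc f)%:~R| < X & h_lt f Y]) ->
    (size s)%:R <= C * (nu R (Sigma n) * (Y ^+ 2 + n%:R)
                          * Num.min (Y ^+ 3) (Num.sqrt X) + n%:R * Y ^+ 2).
Proof.
(* 2106 = 2 * 3 * 351: the rounding 2 per class, three values of t, and the bound 351 n Y^2. The
   main term asks only for 24 * 12 = 288. *)
exists 2106; split => // n X Y n0 X0 Y0 s us hs.
set M := Num.min _ _; set v := nu _ _.
have M0 : 0 <= M by rewrite /M le_min sqrtr_ge0 exprn_ge0 // ltW.
have nR : 0 < n%:R :> R by rewrite ltr0n.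
have v0 : 0 <= v.
  have : 0 <= 3 * n%:R ^+ 3 * v by apply: le_trans (nu_ge R n n0); apply: sumr_ge0.
  by rewrite pmulr_rge0 // mulr_gt0 // exprn_gt0.
(* Y >= 1 is deduced from an element of the list, so the empty list is treated apart. *)
case: s us hs => [|f0 s0] us hs.
  have bound0 : 0 <= v * (Y ^+ 2 + n%:R) * M + n%:R * Y ^+ 2.
    apply: addr_ge0; last by rewrite mulr_ge0 // sqr_ge0.
    by rewrite -mulrA mulr_ge0 // mulr_ge0 // addr_ge0 // sqr_ge0.
  by apply: mulr_ge0 => //; apply: ler0n.
set s := f0 :: s0 in us hs *.
have Y1 : 1 <= Y.
  by have [[_ d0 _] _ h0] := hs f0 (mem_head _ _); apply: height_ge1 h0 d0.
pose ts : seq int := [:: -1; 0; 1].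
pose kap := 8 * M / n%:R ^+ 2 + 2.
pose st t := filter (fun f => cub_t f == t) s.
pose As t := undup (map cub_A (st t)).
pose T t := (\sum_(A <- As t) count_res (n ^ 2) (index_cond n t A))%N.
have hst t : (size (st t))%:R <= (T t)%:R * kap.
  rewrite -sum1_size (sum_fibers _ _ _ (As t) cub_A) ?undup_uniq //; last first.
    by move=> x hx; rewrite mem_undup map_f.
  rewrite /T !natr_sum mulr_suml; apply: ler_sum => A _.
  rewrite -big_filter sum1_size -(size_map cub_B).
  have mem f : f \in filter (fun x => cub_A x == A) (st t) ->
      f \in s /\ f = (t, A, cub_B f).
    rewrite !mem_filter => /andP[/eqP hA /andP[/eqP ht ->]]; split=> //.
    by rewrite -hA -ht; case: (f) => -[].
  apply: (fixed_A_size _ t A) => //.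
    rewrite map_inj_in_uniq ?filter_uniq // => f g /mem[_ ->] /mem[_ ->].
    by rewrite /cub_B /= => ->.
  move=> _ /mapP[f /mem[fs fE] ->].
  have [hS hd hh] := hs f fs; have [_ hB] := coef_bounds _ _ _ hh.
  by split=> //; [apply: Sigma_index_cond => //|]; rewrite -fE.
have sE : (size s)%:R = \sum_(t <- ts) (size (st t))%:R :> R.
  rewrite -sum1_size (sum_fibers _ _ _ ts cub_t) // ?natr_sum.
    by apply: eq_bigr => t _; rewrite -big_filter sum1_size.
  by move=> f /hs[[]].
have hT t : (T t)%:R <= (12 * Y ^+ 2 / n%:R + 1) * (index_count n t)%:R :> R
  /\ (T t)%:R <= 351 * (n%:R * Y ^+ 2) :> R.
  apply: sum_count_index_cond => //; first exact: undup_uniq.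
  move=> A; rewrite mem_undup => /mapP[f + ->]; rewrite mem_filter => /andP[_ fs].
  by have [_ _ /coef_bounds[]] := hs f fs.
have hsum : \sum_(t <- ts) (T t)%:R <= (12 * Y ^+ 2 / n%:R + 1) * (3 * n%:R ^+ 3 * v) :> R.
  apply: (@le_trans _ _ ((12 * Y ^+ 2 / n%:R + 1) * \sum_(t <- ts) (index_count n t)%:R)).
    by rewrite mulr_sumr; apply: ler_sum => t _; case: (hT t).
  apply: ler_wpM2l; last exact: nu_ge.
  by rewrite addr_ge0 // divr_ge0 // mulr_ge0 // exprn_ge0 // ltW.
have hsum2 : \sum_(t <- ts) (T t)%:R <= 1053 * (n%:R * Y ^+ 2) :> R.
  rewrite !big_cons big_nil addr0.
  have [_ t1] := hT (-1); have [_ t2] := hT 0; have [_ t3] := hT 1; lra.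
set Z := \sum_(t <- ts) _ in hsum hsum2.
have : (size s)%:R <= Z * kap.
  by rewrite sE /Z mulr_suml; apply: ler_sum => t _.
rewrite /kap mulrDr => /le_trans; apply.
have nn : n%:R != 0 :> R by rewrite gt_eqF.
(* The factor n^3 from the density against n^2 from the spacing of B leaves one n, and n (12 Y^2 / n
   + 1) = 12 Y^2 + n. *)
have : Z * (8 * M / n%:R ^+ 2) <= 24 * (v * (12 * Y ^+ 2 + n%:R) * M).
  have -> : 24 * (v * (12 * Y ^+ 2 + n%:R) * M) =
     ((12 * Y ^+ 2 / n%:R + 1) * (3 * n%:R ^+ 3 * v)) * (8 * M / n%:R ^+ 2) by field.
  by apply: ler_wpM2r => //; rewrite divr_ge0 ?mulr_ge0 // exprn_ge0.
have p1 : 0 <= v * Y ^+ 2 * M by rewrite -mulrA mulr_ge0 // mulr_ge0 // sqr_ge0.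
have p2 : 0 <= v * n%:R * M by rewrite !mulr_ge0.
have -> : v * (12 * Y ^+ 2 + n%:R) * M = 12 * (v * Y ^+ 2 * M) + v * n%:R * M by ring.
have -> : v * (Y ^+ 2 + n%:R) * M = v * Y ^+ 2 * M + v * n%:R * M by ring.
lra.
Qed.
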